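(* Let $(Y_n,d)$ ($n\in\mathbb{N}^+$), with distinguished points $p,q\in Y_n$, and $(Y_\infty,d)$ be the metric spaces defined in the context. Then for each $n\in\mathbb{N}^+$, in $(Y_n,d)$ one has $d_0^n(p,y)=3+\bar d(q,y)$ for all $y\in Y_n$ with $y\ne p$, and the restrictions of $d_0^n$ and $\bar d$ to $Y_n\smallsetminus\{p\}$ agree. In particular, $$d<d_0<\dots<d_0^{n-1}<d_0^n<d_0^{n+1}=\bar d\quad\text{in } Y_n.$$ In $(Y_\infty,d)$ one has $d_0^n<d_0^{n+1}$ for all $n\in\mathbb{N}$, and $\lim_{n\to\infty}d_0^n<\bar d$ (the limit being taken pointwise).
   Context: Metrics are allowed to take the value $\infty$ (all other metric axioms are as usual). Here $\mathbb{N}$ includes $0$. For $n\in\mathbb{N}^+$, $[n]=\{1,\dots,n\}$. For metrics $\rho,\rho'$ on the same set $X$, $\rho\le\rho'$ means $\rho(x,y)\le\rho'(x,y)$ for all $x,y\in X$, and $\rho<\rho'$ means that $\rho\le\rho'$ and strict inequality holds for at least one pair of points. Let $(X,d)$ be a metric space. Length metric: the $d$-length of a $d$-continuous path $\gamma\colon[0,1]\to X$ is $L(\gamma)=\sup\sum_{k=1}^n d(\gamma(t_{k-1}),\gamma(t_k))$, the supremum being over all finite partitions $0=t_0<t_1<\dots<t_n=1$. The length metric induced by $d$ is $\bar d(x,y)=\inf\{L(\gamma): \gamma\colon[0,1]\to X \text{ is a } d\text{-continuous path joining } x \text{ to } y\}$, with $\inf\emptyset=\infty$. The metric $d_0$: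 for $\varepsilon>0$, an $\varepsilon$-chain joining $x$ to $y$ is a finite string $c=(x_0,\dots,x_n)$ of points of $X$ ($n\in\mathbb{N}^+$) with $x_0=x$, $x_n=y$ and $d(x_{k-1},x_k)\le\varepsilon$ for all $k\in[n]$; its length is $L(c)=\sum_{k=1}^n d(x_{k-1},x_k)$. Set $d_\varepsilon(x,y)=\inf\{L(c): c\text{ is an }\varepsilon\text{-chain joining } x\text{ to } y\}\in[0,\infty]$ and $d_0(x,y)=\sup_{\varepsilon>0}d_\varepsilon(x,y)=\lim_{\varepsilon\to0}d_\varepsilon(x,y)$; this is a metric with values in $[0,\infty]$. Iterates: $d_0^0=d$ and $d_0^{n}=(d_0^{n-1})_0$ for $n\in\mathbb{N}^+$ (the construction $\rho\mapsto\rho_0$ applied to $\rho=d_0^{n-1}$). The space $Y_1$: for each integer $k\ge2$ let $S_k\subset\ell^\infty$ be $$S_k=\{(1,0,\dots,0,t,0,\dots): t\in[0,1]\}\cup\{(t,0,\dots,0,1,0,\dots): t\in[\tfrac1k,1]\}\cup\{(\tfrac1k,0,\dots,0,t,0,\dots): t\in[0,1]\},$$ where in each description the only (possibly) nonzero coordinates are the first and the $k$-th. Let $p=(0,0,\dots)$, $q=(1,0,0,\dots)$ and $Y_1=\{p\}\cup\bigcup_{k=2}^\infty S_k$, with the metric $d$ induced by $\|\cdot\|_\infty$. The spaces $Y_n$, $n\ge2$: assume $Y_{n-1}$ with distinguished points $p,q$ has been defined. For each $m\in\mathbb{N}^+$ take $m$ copies $Z_m^j$ ($j\in[m]$) of $Y_{n-1}$,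 each with its metric contracted by the factor $\frac1m$, i.e. equipped with $\frac1m d_{Y_{n-1}}$. Let $Y_n$ be the result of gluing the disjoint union of all the $Z_m^j$ ($m\in\mathbb{N}^+$, $j\in[m]$) as follows: (a) the point $q$ of $Z_m^j$ is glued to the point $p$ of $Z_m^{j+1}$ for each $j\in[m-1]$ and $m\in\mathbb{N}^+$; (b) the points $p$ of $Z_m^1$, for all $m\in\mathbb{N}^+$, are glued to a single point, denoted $p$; (c) the points $q$ of $Z_m^m$, for all $m\in\mathbb{N}^+$, are glued to a single point, denoted $q$. The metric $d$ on $Y_n$ is the gluing (quotient) metric: $d(x,y)$ is the infimum of sums $\sum_{i=1}^k d(a_i,b_i)$, where for each $i$ the points $a_i,b_i$ lie in the same piece $Z_m^j$ (with distance measured in that piece), $a_1$ represents $x$, $b_k$ represents $y$, and $b_i$ is identified with $a_{i+1}$ for $1\le i<k$. The space $Y_\infty$: $Y_n$ contains an isometric copy of $Y_{n-1}$, namely the image of $Z_1^1$, under which the points $p,q$ of $Y_{n-1}$ are identified with the points $p,q$ of $Y_n$. Regarding $Y_{n-1}$ as a subspace of $Y_n$ in this way, $Y_\infty=\bigcup_{n=1}^\infty Y_n$, with the metric $d$ whose restriction to each $Y_n$ is the metric of $Y_n$. *)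

(* Defs.v *)
From HB Require Import structures.
From mathcomp Require Import all_boot all_order all_algebra.
From mathcomp Require Import all_classical all_reals all_analysis.
From Stdlib Require Relation_Operators.
Import Order.TTheory GRing.Theory Num.Theory.
Import numFieldNormedType.Exports.

Set Implicit Arguments.
Unset Strict Implicit.
Unset Printing Implicit Defensive.

Local Open Scope classical_set_scope.
Local Open Scope ring_scope.

(** Metrics may take the value +oo, so they are functions [X -> X -> \bar R]. *)

Definition metric_le (R : realType) (X : Type) (r r' : X -> X -> \bar R) : Prop :=
  forall x y, (r x y <= r' x y)%E.

Definition metric_lt (R : realType) (X : Type) (r r' : X -> X -> \bar R) : Prop :=
  metric_le r r' /\ exists x y, (r x y < r' x y)%E.

Section LengthMetric.
Context (R : realType) (X : Type) (d : X -> X -> \bar R).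

(* A path is a total function on [R] of which only the values on [0, 1]
   matter. *)
Definition continuous_path (g : R -> X) : Prop :=
  forall t : R, t \in `[0, 1]%R -> forall e : R, 0 < e ->
    \forall s \near t, (s : R) \in `[0, 1]%R -> (d (g t) (g s) < e%:E)%E.

(* The counterpart of [variation] for [d]: [itv_partition 0 1 s] says that
   [0 :: s] is strictly increasing and ends at 1. *)
Definition polygonal_length (g : R -> X) (s : seq R) : \bar R :=
  let F := g \o nth 1 (0 :: s) in
  (\sum_(0 <= k < size s) d (F k) (F k.+1))%E.

Definition path_length (g : R -> X) : \bar R :=
  ereal_sup [set polygonal_length g s | s in itv_partition 0 1].

Definition length_metric (x y : X) : \bar R :=
  ereal_inf [set path_length g
            | g in [set g | [/\ continuous_path g, g 0 = x & g 1 = y]]].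

End LengthMetric.

Section ChainMetric.
Context (R : realType) (X : Type).

Definition is_chain (d : X -> X -> \bar R) (e : R) (x y : X)
    (n : nat) (c : nat -> X) : Prop :=
  [/\ (0 < n)%N, c 0%N = x, c n = y &
      forall k, (k < n)%N -> (d (c k) (c k.+1) <= e%:E)%E].

Definition chain_length (d : X -> X -> \bar R) (n : nat) (c : nat -> X) : \bar R :=
  (\sum_(0 <= k < n) d (c k) (c k.+1))%E.

Definition deps (d : X -> X -> \bar R) (e : R) (x y : X) : \bar R :=
  ereal_inf [set l | exists n c, is_chain d e x y n c /\ l = chain_length d n c].

Definition d0 (d : X -> X -> \bar R) (x y : X) : \bar R :=
  ereal_sup [set deps d e x y | e in [set e : R | 0 < e]].

Definition d0_iter (n : nat) (d : X -> X -> \bar R) : X -> X -> \bar R :=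
  iter n d0 d.

End ChainMetric.

(** The quotient of [T] by the equivalence relation generated by [r]. *)

Section GeneratedQuotient.
Context (T : choiceType) (r : T -> T -> Prop).

Definition gen_rel : rel T :=
  fun x y => `[< Relation_Operators.clos_refl_sym_trans T r x y >].

Lemma gen_rel_refl : reflexive gen_rel.
Proof. by move=> x; apply/asboolP; apply: Relation_Operators.rst_refl. Qed.

Lemma gen_rel_sym : symmetric gen_rel.
Proof.
by move=> x y; apply/asboolP/asboolP; apply: Relation_Operators.rst_sym.
Qed.

Lemma gen_rel_trans : transitive gen_rel.
Proof.
move=> y x z /asboolP xy /asboolP yz; apply/asboolP.
exact: Relation_Operators.rst_trans xy yz.
Qed.

Canonical gen_equiv := EquivRel gen_rel gen_rel_refl gen_rel_sym gen_rel_trans.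

Definition gen_quot : choiceType := {eq_quot gen_equiv}%qT.

Definition gen_class (x : T) : gen_quot := (\pi_({eq_quot gen_equiv}) x)%qT.

End GeneratedQuotient.

(** Metric spaces with two distinguished points. *)

Record bipointed (R : realType) := Bipointed {
  carrier :> choiceType;
  dist : carrier -> carrier -> \bar R;
  pt_p : carrier;
  pt_q : carrier }.
Arguments pt_p {R} _.
Arguments pt_q {R} _.

Section Y1.
Context (R : realType).

Definition linf_dist (x y : nat -> R) : \bar R :=
  ereal_sup [set `|x i - y i|%:E | i in [set: nat]].

(* Coordinates are numbered from 1 in the mathematics and from 0 here:
   [vec k s t] has first coordinate [s] and [k]-th coordinate [t], for
   [2 <= k]. *)
Definition vec (k : nat) (s t : R) : nat -> R :=
  fun i => if i == 0%N then s else if i == k.-1 then t else 0.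

Definition S_set (k : nat) : set (nat -> R) :=
  [set vec k 1 t | t in `[0, 1]] `|`
  [set vec k t 1 | t in `[k%:R^-1, 1]] `|`
  [set vec k k%:R^-1 t | t in `[0, 1]].

Definition Y1_p : nat -> R := fun _ => 0.

Definition Y1_q : nat -> R := fun i => if i == 0%N then 1 else 0.

Definition Y1_set : set (nat -> R) :=
  [set Y1_p] `|` \bigcup_(k in [set k | (2 <= k)%N]) S_set k.

Lemma Y1_p_in : Y1_p \in Y1_set.
Proof. by apply/mem_set; left. Qed.

Lemma Y1_q_in : Y1_q \in Y1_set.
Proof.
apply/mem_set; right; exists 2%N => //; left; left; exists 0.
  by rewrite /= in_itv /= lexx ler01.
by apply/funext => i; rewrite /vec /Y1_q; case: i => // i; rewrite if_same.
Qed.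

Definition Y1 : bipointed R :=
  @Bipointed R (set_type Y1_set : choiceType)
    (fun x y => linf_dist (val x) (val y))
    (exist _ Y1_p Y1_p_in) (exist _ Y1_q Y1_q_in).

End Y1.

Section Gluing.
Context (R : realType) (Y : bipointed R).

(* [m : nat] and [j : 'I_m.+1] stand for the mathematical m + 1 and j + 1, so
   that [piece j y] with [j : 'I_m.+1] is the point [y] of the copy
   Z_(m+1)^(j+1). *)
Definition pieces : choiceType := {m : nat & ('I_m.+1 * Y)%type}.

Definition piece (m : nat) (j : 'I_m.+1) (y : Y) : pieces :=
  existT (fun m => ('I_m.+1 * Y)%type) m (j, y).

Inductive glued : pieces -> pieces -> Prop :=
| glued_next m (i j : 'I_m.+1) : j = i.+1 :> nat ->
    glued (piece i (pt_q Y)) (piece j (pt_p Y))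
| glued_p m m' :
    glued (piece (ord0 : 'I_m.+1) (pt_p Y)) (piece (ord0 : 'I_m'.+1) (pt_p Y))
| glued_q m m' :
    glued (piece (ord_max : 'I_m.+1) (pt_q Y))
          (piece (ord_max : 'I_m'.+1) (pt_q Y)).

Definition glue_carrier : choiceType := gen_quot glued.

Definition glue_pt (m : nat) (j : 'I_m.+1) (y : Y) : glue_carrier :=
  gen_class glued (piece j y).

(* A pair of points [hop_a], [hop_b] of one piece. *)
Record hop := Hop {
  hop_m : nat;
  hop_j : 'I_hop_m.+1;
  hop_a : Y;
  hop_b : Y }.

Definition hop_src (h : hop) : glue_carrier := glue_pt (hop_j h) (hop_a h).

Definition hop_tgt (h : hop) : glue_carrier := glue_pt (hop_j h) (hop_b h).

Definition hop_cost (h : hop) : \bar R :=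
  (((hop_m h).+1%:R^-1)%:E * dist (hop_a h) (hop_b h))%E.

Definition is_hop_chain (x y : glue_carrier) (k : nat) (h : nat -> hop) : Prop :=
  [/\ (0 < k)%N, hop_src (h 0%N) = x, hop_tgt (h k.-1) = y &
      forall i, (i.+1 < k)%N -> hop_tgt (h i) = hop_src (h i.+1)].

Definition glue_dist (x y : glue_carrier) : \bar R :=
  ereal_inf [set l | exists k h,
    is_hop_chain x y k h /\ l = (\sum_(0 <= i < k) hop_cost (h i))%E].

Definition glue : bipointed R :=
  @Bipointed R glue_carrier glue_dist
    (glue_pt (ord0 : 'I_1) (pt_p Y)) (glue_pt (ord0 : 'I_1) (pt_q Y)).

(* The inclusion of [Y] as the piece Z_1^1. *)
Definition glue_inj (y : Y) : glue := glue_pt (ord0 : 'I_1) y.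

Lemma glue_inj_p : glue_inj (pt_p Y) = pt_p glue.
Proof. by []. Qed.

Lemma glue_inj_q : glue_inj (pt_q Y) = pt_q glue.
Proof. by []. Qed.

End Gluing.

Section Spaces.
Context (R : realType).

(* [tower n] is Y_(n+1). *)
Fixpoint tower (n : nat) : bipointed R :=
  if n is n'.+1 then glue (tower n') else Y1 R.

(* Meaningful for [0 < n] only. *)
Definition Y (n : nat) : bipointed R := tower n.-1.

Definition tower_sum : choiceType := {n : nat & tower n}.

Definition in_tower (n : nat) (y : tower n) : tower_sum :=
  existT (fun n => tower n : Type) n y.

Inductive tower_step : tower_sum -> tower_sum -> Prop :=
| Tower_step n (y : tower n) :
    tower_step (in_tower y) (in_tower (glue_inj y : tower n.+1)).

(* The union of the increasing sequence of the Y_n: their disjoint union, in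
   which each point is identified with its image in the next space. *)
Definition Yinf : choiceType := gen_quot tower_step.

Definition to_Yinf (n : nat) (y : tower n) : Yinf :=
  gen_class tower_step (in_tower y).

(* Since the inclusions are isometric, all the common stages [n] give the same
   value, the distance of the two points in Y_(n+1). *)
Definition Yinf_dist (x y : Yinf) : \bar R :=
  ereal_inf [set l | exists n (a b : tower n),
    [/\ to_Yinf a = x, to_Yinf b = y & l = dist a b]].

End Spaces.

(* Main.v *)
(** The inequality d_0^k <= \bar d is general, since (\bar d)_0 = \bar d. Lower
    bounds for d_0^k come from test functions: a real function which is
    1-Lipschitz for [r] on pairs at [r]-distance at most [e] is 1-Lipschitz for
    [r_0].

    The key point is that a [0, 1]-valued function on Y_n whose restriction to
    every piece Z_m^j is 1-Lipschitz for (1/m) d_0^k is 1-Lipschitz for d_0^k of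
    Y_n. For the step from k to k + 1, fix two points: on the two chains that
    contain them, replace the function by a McShane extension of its values,
    shrunk by the factor 1 - eta, on finitely many points, so that it becomes
    1-Lipschitz for (1/m) (d_0^k)_e for some e > 0; on all other chains
    interpolate linearly between p and q, which is possible because
    d(p, q) >= 1.

    By induction, p is isolated for d_0^(n-1) in Y_(n-1), at distance
    d_0^(n-1)(p, q) = 3 from q. So at a small scale only the chains of Y_n with
    many pieces can be crossed, at the total cost m (3/m) = 3: the test function
    z |-> min (K, \bar d(x, z)), modified at p and on the chains with many
    pieces, bounds d_0^n from below. In Y_infinity, d_0^k(p, q) <= 1 for all k,
    while every y <> p satisfies d_0^k(p, y) >= 1 for large k, so that p is
    isolated for \bar d. *)

Require Import Defs.
From mathcomp Require Import all_boot all_order all_algebra.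
From mathcomp Require Import all_classical all_reals all_analysis.
From mathcomp Require Import ring lra.
Import Order.TTheory GRing.Theory Num.Theory.
Import numFieldNormedType.Exports.
(* [glue] is also a name of [mathcomp.classical.functions]. *)
Import Defs.

Set Implicit Arguments.
Unset Strict Implicit.
Unset Printing Implicit Defensive.

Local Open Scope classical_set_scope.
Local Open Scope ring_scope.

(** * Pseudo-metrics and 1-Lipschitz functions *)

Section Chains.
Context (R : realType).

Record pmetric (X : Type) (r : X -> X -> \bar R) : Prop := PMetric {
  pm_refl : forall x, r x x = 0%E;
  pm_sym : forall x y, r x y = r y x;
  pm_tri : forall x y z, (r x z <= r x y + r y z)%E;
  pm_ge0 : forall x y, (0 <= r x y)%E }.

(** No absolute value is taken: the bound is asked of both ordered pairs, and [r] is symmetric in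
    every use. *)
Definition lip_at (X : Type) (e : R) (r : X -> X -> \bar R) (f : X -> R) :=
  forall x y, (r x y <= e%:E)%E -> ((f y - f x)%:E <= r x y)%E.

Definition lip (X : Type) (r : X -> X -> \bar R) (f : X -> R) :=
  forall x y, ((f y - f x)%:E <= r x y)%E.

(** Add two [e / 2]-minimizers. Nonnegativity excludes [-oo], so an infinite infimum makes the sum
    [+oo]. All triangle inequalities for infima over chains come from here. *)
Lemma le_ereal_infD (A B : set \bar R) (v : \bar R) :
  (forall a, A a -> (0 <= a)%E) -> (forall b, B b -> (0 <= b)%E) ->
  (forall a b, A a -> B b -> (v <= a + b)%E) ->
  (v <= ereal_inf A + ereal_inf B)%E.
Proof.
move=> A0 B0 AB.
have iA0 : (0 <= ereal_inf A)%E by apply: le_ereal_inf_tmp.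
have iB0 : (0 <= ereal_inf B)%E by apply: le_ereal_inf_tmp.
have [->|Afin] := eqVneq (ereal_inf A) +oo%E.
  by rewrite addye ?leey// gt_eqF// (lt_le_trans _ iB0)// ltNy0.
have [->|Bfin] := eqVneq (ereal_inf B) +oo%E.
  by rewrite addey ?leey// gt_eqF// (lt_le_trans _ iA0)// ltNy0.
have Af : ereal_inf A \is a fin_num by rewrite ge0_fin_numE// ltey.
have Bf : ereal_inf B \is a fin_num by rewrite ge0_fin_numE// ltey.
apply/lee_addgt0Pr => e e0.
have e20 : 0 < e / 2 by rewrite divr_gt0.
have [a Aa ha] := lb_ereal_inf_adherent e20 Af.
have [b Bb hb] := lb_ereal_inf_adherent e20 Bf.
apply: (le_trans (AB _ _ Aa Bb)).
by rewrite [e]splitr EFinD addeACA leeD// ltW.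
Qed.

Section OnSpace.
Context (X : Type).
Implicit Types (r : X -> X -> \bar R) (f : X -> R).

Lemma lip_lip_at e r f : lip r f -> lip_at e r f.
Proof. by move=> h x y _. Qed.

Lemma chain_length_ge0 r n c : pmetric r -> (0 <= chain_length r n c)%E.
Proof. by move=> hr; apply: sume_ge0 => k _; apply: pm_ge0. Qed.

Lemma deps_ge0 r e x y : pmetric r -> (0 <= deps r e x y)%E.
Proof.
by move=> hr; apply: le_ereal_inf_tmp => _ [n [c [_ ->]]]; exact: chain_length_ge0.
Qed.

Lemma deps_le_dist r e x y : (r x y <= e%:E)%E -> (deps r e x y <= r x y)%E.
Proof.
move=> h; apply: ge_ereal_inf; exists (r x y) => //.
exists 1%N, (fun k => if k is 0%N then x else y); split; last first.
  by rewrite /chain_length big_nat1.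
by split => // -[].
Qed.

Lemma deps_anti r e e' x y : e <= e' -> (deps r e' x y <= deps r e x y)%E.
Proof.
move=> ee'; apply: ereal_inf_le_tmp => _ [n [c [[n0 c0 cn h] ->]]].
exists n, c; split => //; split => // k kn.
by apply: le_trans (h k kn) _; rewrite lee_fin.
Qed.

Lemma deps_le_d0 r e x y : 0 < e -> (deps r e x y <= d0 r x y)%E.
Proof. by move=> e0; apply: ereal_sup_ubound; exists e. Qed.

Lemma deps_sym_le r e x y : pmetric r -> (deps r e y x <= deps r e x y)%E.
Proof.
move=> hr; apply: ereal_inf_le_tmp => _ [n [c [[n0 c0 cn h] ->]]].
exists n, (fun k => c (n - k)%N); split.
  split; rewrite ?subn0 ?subnn// => k kn.
  have nk : (n - k = (n - k.+1).+1)%N by rewrite subnSK.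
  by rewrite nk (pm_sym hr); apply: h; rewrite -nk leq_subr.
rewrite /chain_length big_nat_rev /= add0n !big_nat; apply: eq_bigr => k /andP[_ kn].
by rewrite (pm_sym hr) subnSK.
Qed.

Lemma deps_tri r e x y z : pmetric r ->
  (deps r e x z <= deps r e x y + deps r e y z)%E.
Proof.
move=> hr; apply: le_ereal_infD.
- by move=> _ [n [c [_ ->]]]; exact: chain_length_ge0.
- by move=> _ [n [c [_ ->]]]; exact: chain_length_ge0.
move=> _ _ [n [c [[n0 c0 cn h] ->]]] [n' [c' [[n'0 c'0 c'n h'] ->]]].
pose c2 k := if (k <= n)%N then c k else c' (k - n)%N.
have c2r k : c2 (k + n)%N = c' k.
  rewrite /c2; case: k => [|k]; first by rewrite add0n leqnn cn c'0.
  by rewrite leqNgt addSn ltnS leq_addl /= -addSn addnK.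
have c2l k : (k <= n)%N -> c2 k = c k by rewrite /c2 => ->.
apply: ge_ereal_inf; exists (chain_length r (n' + n) c2); last first.
  rewrite /chain_length (@big_cat_nat _ _ _ n)//= ?leq_addl// leeD//.
    rewrite !big_nat; apply: lee_sum => k /andP[_ kn].
    by rewrite !c2l// ltnW.
  rewrite -{1}[n]add0n big_addn addnK; apply: lee_sum => k _.
  by rewrite -addSn !c2r.
exists (n' + n)%N, c2; split => //; split.
- by rewrite addn_gt0 n0 orbT.
- by rewrite c2l.
- by rewrite c2r.
move=> k kn; case: (ltnP k n) => [kn'|nk]; first by rewrite !c2l ?(ltnW kn')//; exact: h.
rewrite -(subnK nk) -addSn !c2r; apply: h'.
by rewrite ltn_subLR// addnC.
Qed.

Lemma le_d0 r x y : pmetric r -> (r x y <= d0 r x y)%E.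
Proof.
move=> hr; apply: le_trans (deps_le_d0 r x y ltr01).
apply: le_ereal_inf_tmp => _ [n [c [[n0 <- <- h] ->]]].
rewrite /chain_length; elim: n {n0 h} => [|n IH].
  by rewrite (pm_refl hr) big_geq.
by rewrite big_nat_recr//=; apply: le_trans (pm_tri hr _ (c n) _) _; exact: leeD.
Qed.

Lemma deps_pmetric r e : 0 < e -> pmetric r -> pmetric (deps r e).
Proof.
move=> e0 hr; split; [|by move=> *; apply/eqP; rewrite eq_le !deps_sym_le|
  by move=> *; exact: deps_tri|by move=> *; exact: deps_ge0].
move=> x; apply/eqP; rewrite eq_le deps_ge0// andbT.
by apply: le_trans (deps_le_dist _) _; rewrite (pm_refl hr)// lee_fin ltW.
Qed.

Lemma d0_pmetric r : pmetric r -> pmetric (d0 r).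
Proof.
move=> hr; split.
- move=> x; apply/eqP; rewrite eq_le; apply/andP; split; last first.
    by apply: le_trans (le_d0 _ _ hr); exact: pm_ge0.
  by apply: ge_ereal_sup => _ [e /= e0 <-]; rewrite (pm_refl (deps_pmetric e0 hr)).
- move=> x y; rewrite /d0; congr ereal_sup; apply/seteqP; split=> _ [e /= e0 <-];
  by exists e => //; exact: pm_sym (deps_pmetric e0 hr) _ _.
- move=> x y z; apply: ge_ereal_sup => _ [e /= e0 <-].
  by apply: le_trans (deps_tri _ _ y _ hr) _; apply: leeD; exact: deps_le_d0.
- by move=> x y; apply: le_trans (le_d0 _ _ hr); exact: pm_ge0.
Qed.

Lemma d0_iterS k r : d0_iter k.+1 r = d0 (d0_iter k r).
Proof. by []. Qed.

Lemma d0_iter_pmetric k r : pmetric r -> pmetric (d0_iter k r).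
Proof. by move=> hr; elim: k => //= k IH; exact: d0_pmetric. Qed.

Lemma d0_iter_leS k r x y : pmetric r -> (d0_iter k r x y <= d0_iter k.+1 r x y)%E.
Proof. by move=> hr; apply: le_d0; exact: d0_iter_pmetric. Qed.

Lemma d0_iter_nondec k k' r x y : pmetric r -> (k <= k')%N ->
  (d0_iter k r x y <= d0_iter k' r x y)%E.
Proof.
move=> hr /subnK <-; elim: (k' - k)%N => // n IH.
by apply: le_trans IH _; rewrite addSn; exact: d0_iter_leS.
Qed.

(** Along an [e]-chain the increments of [f] telescope, and each is bounded by its step. This is the
    source of all lower bounds for [d0]. *)
Lemma lip_at_d0 e r f : 0 < e -> pmetric r -> lip_at e r f -> lip (d0 r) f.
Proof.
move=> e0 hr hf x y; apply: le_trans (deps_le_d0 _ _ _ e0).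
apply: le_ereal_inf_tmp => _ [n [c [[n0 <- <- h] ->]]].
rewrite /chain_length; elim: n h {n0} => [|n IH] h; first by rewrite big_geq// subrr.
rewrite big_nat_recr//=.
have -> : f (c n.+1) - f (c 0%N) = (f (c n) - f (c 0%N)) + (f (c n.+1) - f (c n)) by lra.
rewrite EFinD; apply: leeD; first by apply: IH => k kn; apply: h; rewrite ltnW.
by apply: hf; exact: h.
Qed.

End OnSpace.

(** [phi] carries an [e / c]-chain to an [e]-chain and multiplies its length by at most [c]. *)
Lemma d0_scale (X X' : Type) (r : X -> X -> \bar R) (r' : X' -> X' -> \bar R)
    (phi : X -> X') (c : R) : 0 < c -> pmetric r ->
  (forall a b, (r' (phi a) (phi b) <= c%:E * r a b)%E) ->
  forall a b, (d0 r' (phi a) (phi b) <= c%:E * d0 r a b)%E.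
Proof.
move=> c0 hr h a b; apply: ge_ereal_sup => _ [e /= e0 <-].
have ec0 : 0 < c^-1 * e by rewrite mulr_gt0 ?invr_gt0.
apply: le_trans (lee_wpmul2l _ (deps_le_d0 r a b ec0)); last by rewrite lee_fin ltW.
rewrite -lee_pdivrMl//; apply: le_ereal_inf_tmp => _ [n [ch [[n0 <- <- hch] ->]]].
rewrite lee_pdivrMl//; apply: ge_ereal_inf.
exists (chain_length r' n (phi \o ch)).
  exists n, (phi \o ch); split => //; split => // k kn /=.
  by apply: le_trans (h _ _) _; rewrite -lee_pdivlMl// -EFinM; exact: hch.
rewrite /chain_length ge0_sume_distrr; last by move=> *; exact: pm_ge0.
by apply: lee_sum => k _ /=; exact: h.
Qed.

Lemma d0_iter_scale (X X' : Type) (r : X -> X -> \bar R) (r' : X' -> X' -> \bar R)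
    (phi : X -> X') (c : R) (k : nat) : 0 < c -> pmetric r ->
  (forall a b, (r' (phi a) (phi b) <= c%:E * r a b)%E) ->
  forall a b, (d0_iter k r' (phi a) (phi b) <= c%:E * d0_iter k r a b)%E.
Proof.
move=> c0 hr h; elim: k => //= k IH.
by apply: d0_scale => //; exact: d0_iter_pmetric.
Qed.

Lemma d0_le (X : Type) (r r' : X -> X -> \bar R) : pmetric r ->
  (forall x y, (r' x y <= r x y)%E) -> forall x y, (d0 r' x y <= d0 r x y)%E.
Proof.
move=> hr h x y; rewrite -[leRHS]mul1e.
by apply: (@d0_scale _ _ _ _ id) => // a b; rewrite mul1e.
Qed.

Lemma pmetric_scale (X : Type) (r : X -> X -> \bar R) (c : R) : 0 <= c ->
  pmetric r -> pmetric (fun a b => c%:E * r a b)%E.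
Proof.
move=> c0 hr; split=> [x|x y|x y z|x y].
- by rewrite (pm_refl hr) mule0.
- by rewrite (pm_sym hr).
- by rewrite -ge0_muleDr ?(pm_ge0 hr)// lee_wpmul2l ?lee_fin// (pm_tri hr).
- by rewrite mule_ge0 ?lee_fin// (pm_ge0 hr).
Qed.

(** * Truncated distances as real test functions *)

Section Truncation.
Context (X : Type) (r : X -> X -> \bar R) (r_pm : pmetric r) (c : R) (c0 : 0 <= c).

Definition trunc a b : R := fine (mine c%:E (r a b)).

Lemma truncE a b : (trunc a b)%:E = mine c%:E (r a b).
Proof.
rewrite /trunc fineK// ge0_fin_numE; last by rewrite le_min lee_fin c0 (pm_ge0 r_pm).
by rewrite gt_min ltry.
Qed.

Lemma trunc_ge0 a b : 0 <= trunc a b.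
Proof. by rewrite -lee_fin truncE le_min lee_fin c0 (pm_ge0 r_pm). Qed.

Lemma trunc_le a b : trunc a b <= c.
Proof. by rewrite -lee_fin truncE ge_min lexx. Qed.

Lemma trunc_refl a : trunc a a = 0.
Proof. by apply: EFin_inj; rewrite truncE (pm_refl r_pm) min_r// lee_fin. Qed.

Lemma trunc_eq a b : (c%:E <= r a b)%E -> trunc a b = c.
Proof. by move=> h; apply: EFin_inj; rewrite truncE min_l. Qed.

Lemma trunc_ge a b v : v <= c -> (v%:E <= r a b)%E -> v <= trunc a b.
Proof. by move=> vc h; rewrite -lee_fin truncE le_min lee_fin vc. Qed.

Lemma trunc_lip x a b : ((trunc x b - trunc x a)%:E <= r a b)%E.
Proof.
rewrite EFinB leeBlDr// !truncE addeC.
have [|h] := leP c%:E (r x a).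
  by move=> _; apply: (@le_trans _ _ c%:E); rewrite ?ge_min ?lexx// leeDl// (pm_ge0 r_pm).
by rewrite ge_min (pm_tri r_pm) orbT.
Qed.

Lemma trunc_dist_lip x a b : (`|trunc x b - trunc x a|%:E <= r a b)%E.
Proof.
have [_|_] := ger0P (trunc x b - trunc x a); first exact: trunc_lip.
by rewrite opprB (pm_sym r_pm) trunc_lip.
Qed.

End Truncation.

End Chains.

(** * The length metric *)

Section LengthMetricTheory.
Context (R : realType) (X : Type) (d : X -> X -> \bar R) (d_pm : pmetric d).
Implicit Types (g : R -> X) (V : R -> R).

(** The polygonal length with a free starting parameter, so that induction on the partition
    applies. *)
Fixpoint poly_length g (a : R) (s : seq R) : \bar R :=
  if s is b :: s' then (d (g a) (g b) + poly_length g b s')%E else 0%E.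

Lemma polygonal_lengthE g s : polygonal_length d g s = poly_length g 0%R s.
Proof.
rewrite /polygonal_length /=; move: {1 2}(0 : R) => a.
elim: s a => [|b s IH] a /=; first by rewrite big_geq.
by rewrite big_nat_recl//= -IH.
Qed.

Lemma poly_length_ge0 g a s : (0 <= poly_length g a s)%E.
Proof. by elim: s a => //= b s IH a; rewrite adde_ge0// (pm_ge0 d_pm). Qed.

Lemma poly_length_rcons g a s t :
  poly_length g a (rcons s t) = (poly_length g a s + d (g (last a s)) (g t))%E.
Proof. by elim: s a => [|b s IH] a /=; rewrite ?adde0 ?add0e// IH addeA. Qed.

(** [V] stands for arc length along [g]. Any function whose increments dominate the chords will do,
    so explicit paths can come with an explicit [V]. *)
Definition var_bound g V :=
  forall s t, 0 <= s -> s <= t -> t <= 1 -> (d (g s) (g t) <= (V t - V s)%:E)%E.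

Lemma poly_length_var g V a s : var_bound g V -> 0 <= a -> path <%R a s ->
  last a s <= 1 -> (poly_length g a s <= (V (last a s) - V a)%:E)%E.
Proof.
move=> hV; elim: s a => [|b s IH] a a0 /=; first by rewrite subrr.
move=> /andP[ab bs] l1; have b0 : 0 <= b by rewrite (le_trans a0)// ltW.
have bl : b <= last b s.
  by apply: (@itv_partition_le _ _ b (last b s) s); split.
have -> : V (last b s) - V a = (V b - V a) + (V (last b s) - V b) by lra.
by rewrite EFinD leeD// ?IH// hV// ?(ltW ab)// (le_trans bl).
Qed.

Lemma path_length_le g V : var_bound g V ->
  (path_length d g <= (V 1 - V 0)%:E)%E.
Proof.
move=> hV; apply: ge_ereal_sup => _ [s [ps /eqP ls] <-].
rewrite polygonal_lengthE; apply: le_trans (poly_length_var hV (lexx 0) ps _) _.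
  by rewrite ls.
by rewrite ls.
Qed.

Lemma path_length_ge g : (d (g 0%R) (g 1%R) <= path_length d g)%E.
Proof.
apply: ereal_sup_ubound; exists [:: 1]; last by rewrite polygonal_lengthE /= adde0.
by apply: itv_partition1; exact: ltr01.
Qed.

(* [V t] is the length of [g] restricted to [0, t]. *)
Lemma path_length_var g (L : R) : path_length d g = L%:E ->
  exists V, [/\ var_bound g V, V 1 - V 0 = L &
    forall e : R, 0 < e -> exists s, [/\ path <%R 0 s, last 0 s = 1 &
      ((V 1 - V 0 - e)%:E <= poly_length g 0%R s)%E]].
Proof.
move=> hL.
pose W (t : R) := ereal_sup [set poly_length g 0%R s | s in itv_partition 0 t].
have W1 : W 1 = L%:E.
  rewrite -hL /W /path_length; congr ereal_sup; apply/seteqP.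
  by split=> _ [s hs <-]; exists s; rewrite // polygonal_lengthE.
(* Appending [t] to a partition of [0, s] adds one chord to its polygon. The case [s = t] is
   separate because partitions are strictly increasing. *)
have Wmono (s t : R) : 0 <= s -> s <= t -> forall p, itv_partition 0 s p ->
    (poly_length g 0%R p + d (g s) (g t) <= W t)%E.
  move=> s0; rewrite le_eqVlt => /predU1P[<- p hp|st p [pp /eqP lp]].
    by rewrite (pm_refl d_pm) adde0; apply: ereal_sup_ubound; exists p.
  apply: ereal_sup_ubound; exists (rcons p t); last by rewrite poly_length_rcons lp.
  by split; rewrite ?last_rcons// rcons_path pp lp.
have part (t : R) : 0 <= t -> exists p, itv_partition 0 t p.
  rewrite le_eqVlt => /predU1P[<-|t0]; first by exists [::]; split.
  by exists [:: t]; exact: itv_partition1.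
have W0 (t : R) : 0 <= t -> (0 <= W t)%E.
  move=> t0; have [p hp] := part t t0.
  apply: le_trans (Wmono t t t0 (lexx _) p hp).
  by rewrite adde_ge0 ?poly_length_ge0 ?(pm_ge0 d_pm).
have Wle (t : R) : 0 <= t -> t <= 1 -> (W t <= L%:E)%E.
  move=> t0 t1; apply: ge_ereal_sup => _ [p hp <-]; rewrite -W1.
  by apply: le_trans (Wmono t 1 t0 t1 p hp); rewrite leeDl// (pm_ge0 d_pm).
have Wf (t : R) : 0 <= t -> t <= 1 -> W t = (fine (W t))%:E.
  move=> t0 t1; rewrite fineK// ge0_fin_numE ?W0//.
  by apply: le_lt_trans (Wle t t0 t1) _; rewrite ltry.
have WL : fine (W 1) = L by rewrite W1.
have WZ : fine (W 0) = 0.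
  suff -> : W 0 = 0%E by [].
  rewrite /W (_ : [set _ | _ in _] = [set 0%E]) ?ereal_sup1//.
  apply/seteqP; split => [_ [p /itv_partitionxx -> <-]|_ ->] //=.
  by exists [::] => //; split.
exists (fun t => fine (W t)); split.
- move=> s t s0 st t1; have t0 : 0 <= t by exact: le_trans st.
  have dst : (d (g s) (g t) <= W t)%E.
    have [p hp] := part s s0; apply: le_trans (Wmono s t s0 st p hp).
    by rewrite leeDr// poly_length_ge0.
  have df : d (g s) (g t) \is a fin_num.
    rewrite ge0_fin_numE ?(pm_ge0 d_pm)//; apply: le_lt_trans dst _.
    by rewrite Wf// ltry.
  rewrite EFinB -!Wf// ?(le_trans st)//.
  rewrite leeBrDr; last by rewrite Wf// (le_trans st).
  rewrite addeC -leeBrDr//; apply: ge_ereal_sup => _ [p hp <-].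
  by rewrite leeBrDr//; exact: Wmono.
- by rewrite WL WZ subr0.
move=> e e0; have : ((L - e)%:E < W 1%R)%E by rewrite W1 lte_fin; lra.
move=> /ereal_sup_gtP[_ [p [pp /eqP lp] <-] hp]; exists p; split => //.
by rewrite WL WZ subr0 ltW.
Qed.

Lemma continuous_pathP g : continuous_path d g <->
  (forall t, 0 <= t -> t <= 1 -> forall e, 0 < e -> exists2 r : R, 0 < r &
    forall s, 0 <= s -> s <= 1 -> `|t - s| < r -> (d (g t) (g s) < e%:E)%E).
Proof.
split=> h t.
  move=> t0 t1 e e0.
  have /h/(_ e e0)/nbhs_ballP[r /= r0 hr] : t \in `[0, 1]%R by rewrite in_itv /= t0.
  by exists r => // s s0 s1 ts; apply: hr => //; rewrite in_itv /= s0.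
rewrite in_itv /= => /andP[t0 t1] e e0; have [r r0 hr] := h t t0 t1 e e0.
apply/nbhs_ballP; exists r => // s /= ts; rewrite in_itv /= => /andP[s0 s1].
exact: hr.
Qed.

Definition route x y g V :=
  [/\ continuous_path d g, g 0 = x, g 1 = y & var_bound g V].

Lemma route_le x y g V : route x y g V ->
  (length_metric d x y <= (V 1 - V 0)%:E)%E.
Proof.
move=> [cg g0 g1 hV]; apply: ge_ereal_inf; exists (path_length d g).
  by exists g.
exact: path_length_le.
Qed.

Lemma length_metric_lt x y (L : R) : (length_metric d x y < L%:E)%E ->
  exists g V, [/\ route x y g V, V 1 - V 0 < L &
    forall e : R, 0 < e -> exists s, [/\ path <%R 0 s, last 0 s = 1 &
      ((V 1 - V 0 - e)%:E <= poly_length g 0%R s)%E]].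
Proof.
move=> /ereal_inf_ltP[_ [g [cg g0 g1] <-] hg].
have pl0 : (0 <= path_length d g)%E.
  by apply: le_trans (path_length_ge g); exact: pm_ge0.
have plf : path_length d g = (fine (path_length d g))%:E.
  by rewrite fineK// ge0_fin_numE// (lt_trans hg)// ltry.
have [V [hV VL Ve]] := path_length_var plf.
by exists g, V; split => //; rewrite VL -lte_fin -plf.
Qed.

Lemma length_metric_ge0 x y : (0 <= length_metric d x y)%E.
Proof.
apply: le_ereal_inf_tmp => _ [g _ <-].
by apply: le_trans (path_length_ge g); exact: pm_ge0.
Qed.

Lemma le_length_metric x y : (d x y <= length_metric d x y)%E.
Proof.
apply: le_ereal_inf_tmp => _ [g [_ <- <-] <-]; exact: path_length_ge.
Qed.

(** Paths of infinite length do not affect the infimum, and a path of finite length has its arc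
    length as [V]. It therefore suffices to test against routes. *)
Lemma length_metric_le_add x y (v : \bar R) :
  (forall g V, route x y g V -> (v <= (V 1 - V 0)%:E)%E) ->
  (v <= length_metric d x y)%E.
Proof.
move=> h; have [->|lf] := eqVneq (length_metric d x y) +oo%E; first by rewrite leey.
have lE : length_metric d x y = (fine (length_metric d x y))%:E.
  by rewrite fineK// ge0_fin_numE ?length_metric_ge0// ltey.
apply/lee_addgt0Pr => e e0.
have : (length_metric d x y < (fine (length_metric d x y) + e)%:E)%E.
  by rewrite {1}lE lte_fin; lra.
move=> /length_metric_lt[g [V [hr VL _]]].
by apply: le_trans (h g V hr) _; rewrite lE -EFinD lee_fin ltW.
Qed.

Lemma continuous_path_comp g (phi : R -> R) (c : R) : 0 < c ->
  (forall t, 0 <= t -> t <= 1 -> 0 <= phi t <= 1) ->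
  (forall s t, `|phi s - phi t| <= c * `|s - t|) ->
  continuous_path d g -> continuous_path d (g \o phi).
Proof.
move=> c0 phi01 phic /continuous_pathP cg; apply/continuous_pathP => t t0 t1 e e0.
have /andP[p0 p1] := phi01 t t0 t1.
have [r r0 hr] := cg _ p0 p1 e e0; exists (r / c); first by rewrite divr_gt0.
move=> s s0 s1 ts; have /andP[q0 q1] := phi01 s s0 s1; apply: hr => //.
by apply: le_lt_trans (phic _ _) _; rewrite mulrC -ltr_pdivlMr.
Qed.

Lemma length_metric_refl x : length_metric d x x = 0%E.
Proof.
apply/eqP; rewrite eq_le length_metric_ge0 andbT.
have [] : route x x (fun=> x) (fun=> 0); last first.
  by move=> cx _ _ vx; apply: le_trans (@route_le _ _ (fun=> x) (fun=> 0) _) _; rewrite ?subrr.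
split => //.
  apply/continuous_pathP => t _ _ e e0; exists 1 => // s _ _ _.
  by rewrite (pm_refl d_pm).
by move=> s t _ _ _; rewrite (pm_refl d_pm) subrr.
Qed.

Lemma length_metric_sym_le x y : (length_metric d y x <= length_metric d x y)%E.
Proof.
apply: length_metric_le_add => g V [cg g0 g1 hV].
have -> : V 1 - V 0 = (fun t => - V (1 - t)) 1 - (fun t => - V (1 - t)) 0.
  by rewrite subrr subr0; lra.
apply: (@route_le _ _ (g \o (fun t => 1 - t)) (fun t => - V (1 - t))); split => /=.
- apply: (@continuous_path_comp _ _ 1) => //.
    by move=> t t0 t1; lra.
  by move=> s t; rewrite mul1r opprB addrC addrA subrK distrC.
- by rewrite subr0.
- by rewrite subrr.
move=> s t s0 st t1 /=; rewrite (pm_sym d_pm).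
have -> : - V (1 - t) - - V (1 - s) = V (1 - s) - V (1 - t) by lra.
by apply: hV; lra.
Qed.

Lemma length_metric_tri x y z :
  (length_metric d x z <= length_metric d x y + length_metric d y z)%E.
Proof.
have [->|lf] := eqVneq (length_metric d y z) +oo%E.
  by rewrite addey ?leey// gt_eqF// (lt_le_trans _ (length_metric_ge0 _ _))// ltNy0.
have lE : length_metric d y z = (fine (length_metric d y z))%:E.
  by rewrite fineK// ge0_fin_numE ?length_metric_ge0// ltey.
rewrite lE -leeBlDr//; apply: length_metric_le_add => g1 V1 [cg1 g10 g11 hV1].
rewrite leeBlDr// addeC -leeBlDr// -lE.
apply: length_metric_le_add => g2 V2 [cg2 g20 g21 hV2].
rewrite leeBlDr//.
(* Concatenation: [g1 \o p1] rests at [y] on the second half and [g2 \o p2] on the first. A chord of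
   [g] is thus at most the sum of the two chords, and [V1 \o p1 + V2 \o p2] bounds the variation. *)
pose p1 (t : R) : R := Num.min (2 * t) 1; pose p2 (t : R) : R := Num.max (2 * t - 1) 0.
pose g (t : R) := if t <= 2^-1 then g1 (p1 t) else g2 (p2 t).
have gle (s t : R) : (d (g s) (g t) <= d (g1 (p1 s)) (g1 (p1 t)) + d (g2 (p2 s)) (g2 (p2 t)))%E.
  have p1h (u : R) : ~~ (u <= 2^-1) -> g1 (p1 u) = y.
    by move=> hu; rewrite -g11 /p1; congr g1; rewrite /Num.min; case: ifPn; lra.
  have p2h (u : R) : u <= 2^-1 -> g2 (p2 u) = y.
    by move=> hu; rewrite -g20 /p2; congr g2; rewrite /Num.max; case: ifPn; lra.
  rewrite /g; case: ifPn => hs; case: ifPn => ht.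
  - by rewrite leeDl// (pm_ge0 d_pm).
  - by rewrite (p1h t)// (p2h s)// (pm_tri d_pm).
  - by rewrite (p1h s)// (p2h t)// addeC (pm_tri d_pm).
  - by rewrite leeDr// (pm_ge0 d_pm).
have p1m (s t : R) : s <= t -> p1 s <= p1 t.
  by rewrite /p1 /Num.min => st; case: ifPn; case: ifPn; lra.
have p2m (s t : R) : s <= t -> p2 s <= p2 t.
  by rewrite /p2 /Num.max => st; case: ifPn; case: ifPn; lra.
have p101 (t : R) : 0 <= t -> t <= 1 -> 0 <= p1 t <= 1.
  by rewrite /p1 /Num.min => t0 t1; case: ifPn; lra.
have p201 (t : R) : 0 <= t -> t <= 1 -> 0 <= p2 t <= 1.
  by rewrite /p2 /Num.max => t0 t1; case: ifPn; lra.
have -> : ((V2 1 - V2 0)%:E + (V1 1 - V1 0)%:E)%E =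
    ((fun t => V1 (p1 t) + V2 (p2 t)) 1 - (fun t => V1 (p1 t) + V2 (p2 t)) 0)%:E.
  have -> : p1 1 = 1 by rewrite /p1 /Num.min; case: ifPn; lra.
  have -> : p1 0 = 0 by rewrite /p1 /Num.min; case: ifPn; lra.
  have -> : p2 1 = 1 by rewrite /p2 /Num.max; case: ifPn; lra.
  have -> : p2 0 = 0 by rewrite /p2 /Num.max; case: ifPn; lra.
  by rewrite -EFinD; congr EFin; lra.
apply: (@route_le _ _ g (fun t => V1 (p1 t) + V2 (p2 t))); split.
- have c1 : continuous_path d (g1 \o p1).
    apply: (@continuous_path_comp _ _ 2) => // s t.
    have := ler_norm (s - t); have := ler_norm (t - s); rewrite (distrC t) ler_norml.
    by rewrite /p1 /Num.min; case: ifPn; case: ifPn; lra.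
  have c2 : continuous_path d (g2 \o p2).
    apply: (@continuous_path_comp _ _ 2) => // s t.
    have := ler_norm (s - t); have := ler_norm (t - s); rewrite (distrC t) ler_norml.
    by rewrite /p2 /Num.max; case: ifPn; case: ifPn; lra.
  apply/continuous_pathP => t t0 t1 e e0; have e20 : 0 < e / 2 by lra.
  move/continuous_pathP: c1 => /(_ t t0 t1 _ e20)[r1 r10 h1].
  move/continuous_pathP: c2 => /(_ t t0 t1 _ e20)[r2 r20 h2].
  exists (Num.min r1 r2); first by rewrite lt_min r10.
  move=> s s0 s1; rewrite lt_min => /andP[ts1 ts2].
  apply: le_lt_trans (gle _ _) _; rewrite [e]splitr EFinD.
  by apply: lteD; [exact: h1|exact: h2].
- by rewrite /g ifT ?invr_ge0// -g10 /p1; congr g1; rewrite /Num.min; case: ifPn; lra.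
- rewrite /g ifF; last by lra.
  by rewrite -g21 /p2; congr g2; rewrite /Num.max; case: ifPn; lra.
move=> s t s0 st t1; apply: le_trans (gle _ _) _.
have -> : V1 (p1 t) + V2 (p2 t) - (V1 (p1 s) + V2 (p2 s)) =
  (V1 (p1 t) - V1 (p1 s)) + (V2 (p2 t) - V2 (p2 s)) by lra.
have s1 : s <= 1 by lra.
have t0 : 0 <= t by lra.
have /andP[? ?] := p101 s s0 s1; have /andP[? ?] := p201 s s0 s1.
have /andP[? ?] := p101 t t0 t1; have /andP[? ?] := p201 t t0 t1.
by rewrite EFinD; apply: leeD; [apply: hV1|apply: hV2] => //; auto.
Qed.

Lemma length_metric_pmetric : pmetric (length_metric d).
Proof.
split; [exact: length_metric_refl| |exact: length_metric_tri|exact: length_metric_ge0].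
by move=> x y; apply/eqP; rewrite eq_le !length_metric_sym_le.
Qed.

Lemma length_metric_route g V u v : continuous_path d g -> var_bound g V ->
  0 <= u -> u <= v -> v <= 1 -> (length_metric d (g u) (g v) <= (V v - V u)%:E)%E.
Proof.
move=> cg hV u0 uv v1; pose phi (t : R) := u + t * (v - u).
have phi01 (t : R) : 0 <= t -> t <= 1 -> 0 <= phi t <= 1 by rewrite /phi => t0 t1; nra.
have phi0 : phi 0 = u by rewrite /phi mul0r addr0.
have phi1 : phi 1 = v by rewrite /phi mul1r addrC subrK.
have -> : V v - V u = (V \o phi) 1 - (V \o phi) 0 by rewrite /= phi0 phi1.
apply: (@route_le _ _ (g \o phi) (V \o phi)); split; rewrite /= ?phi0 ?phi1//.
  apply: (@continuous_path_comp _ _ 1) => // s t.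
  have -> : phi s - phi t = (v - u) * (s - t) by rewrite /phi; lra.
  by rewrite normrM; apply: ler_wpM2r => //; rewrite ger0_norm; lra.
move=> s t s0 st t1.
have /andP[? ?] := phi01 s s0 (le_trans st t1).
have /andP[? ?] := phi01 t (le_trans s0 st) t1.
by apply: hV => //; rewrite /phi; nra.
Qed.

(* Where the inscribed polygon is [eta]-close to the length, a short chord
   subtends a short arc. *)
Lemma deps_length_arc g V eta a b : continuous_path d g -> var_bound g V ->
  0 < eta -> 0 <= a -> a <= b -> b <= 1 ->
  ((V b - V a - eta)%:E <= d (g a) (g b))%E ->
  (deps (length_metric d) (2 * eta) (g a) (g b) <= (V b - V a)%:E)%E.
Proof.
move=> cg hV eta0 a0 ab b1 hab.
have dpm := length_metric_pmetric.
pose D := length_metric d.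
(* The arc over [a, b] exceeds its chord by at most [eta], hence so does every subarc. A chord of at
   most [eta] then subtends an arc of at most [2 * eta], which is one admissible step. *)
have small (u v : R) : a <= u -> u <= v -> v <= b -> (d (g u) (g v) <= eta%:E)%E ->
    (deps D (2 * eta) (g u) (g v) <= (V v - V u)%:E)%E.
  move=> au uv vb duv.
  have h1 : (D (g u) (g v) <= (V v - V u)%:E)%E by apply: length_metric_route => //; lra.
  apply: (le_trans _ h1); apply: deps_le_dist; apply: (le_trans h1); rewrite lee_fin.
  have h2 : (d (g a) (g b) <= (V u - V a)%:E + eta%:E + (V b - V v)%:E)%E.
    apply: le_trans (pm_tri d_pm _ (g v) _) _; apply: leeD; last by apply: hV; lra.
    apply: le_trans (pm_tri d_pm _ (g u) _) _; apply: leeD => //.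
    by apply: hV; lra.
  by have := le_trans hab h2; rewrite -!EFinD lee_fin; lra.
(* Continuous induction: the supremum of the parameters reached by such chains is itself reached, by
   continuity of [g]; were it below [b], one more step would pass it. *)
pose T := [set t : R | a <= t <= b /\ (deps D (2 * eta) (g a) (g t) <= (V t - V a)%:E)%E].
have Ta : T a.
  split; first by rewrite lexx ab.
  by apply: small => //; rewrite (pm_refl d_pm) lee_fin ltW.
have hT : has_sup T by split; [exists a|exists b => t [/andP[]]].
have step (u v : R) : T u -> u <= v -> v <= b -> (d (g u) (g v) <= eta%:E)%E -> T v.
  move=> [/andP[au ub] hu] uv vb duv; split; first by rewrite vb andbT; lra.
  apply: le_trans (deps_tri _ _ (g u) _ dpm) _.
  have -> : V v - V a = (V u - V a) + (V v - V u) by lra.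
  by rewrite EFinD; apply: leeD => //; exact: small.
pose c := sup T.
have ac : a <= c by apply: ub_le_sup => //; exact: hT.2.
have cb : c <= b by apply: ge_sup; [exists a|move=> t [/andP[]]].
have c0 : 0 <= c by lra. have c1 : c <= 1 by lra.
move/continuous_pathP: (cg) => /(_ c c0 c1 eta eta0)[r r0 hr].
have Tc : T c.
  have [u Tu hu] := sup_adherent r0 hT; rewrite -/c in hu.
  have uc : u <= c by apply: ub_le_sup => //; exact: hT.2.
  apply: (step u) => //; rewrite (pm_sym d_pm); apply: ltW; case: (Tu) => /andP[au _] _.
  by apply: hr; rewrite ?ger0_norm; lra.
have [cb'|bc] := ltP c b; last first.
  have cbE : c = b by lra.
  by case: Tc; rewrite cbE.
pose v := Num.min b (c + r / 2).
have cv : c < v by rewrite /v lt_min cb'; lra.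
have : T v.
  have vb : v <= b by rewrite /v ge_min lexx.
  have vr : v <= c + r / 2 by rewrite /v ge_min lexx orbT.
  apply: (step c) => //; first exact: ltW.
  by apply: ltW; apply: hr; rewrite ?ler0_norm; lra.
have vc : T v -> v <= c by move=> Tv; apply: ub_le_sup => //; exact: hT.2.
by move=> /vc vc'; exfalso; lra.
Qed.

(** Every chord is at most its arc, so the total excess [eta] of the arc over the polygon also
    bounds the excess on each single segment. *)
Lemma deps_length_poly g V eta a s : continuous_path d g -> var_bound g V ->
  0 < eta -> 0 <= a -> path <%R a s -> last a s <= 1 ->
  ((V (last a s) - V a - eta)%:E <= poly_length g a s)%E ->
  (deps (length_metric d) (2 * eta) (g a) (g (last a s)) <= (V (last a s) - V a)%:E)%E.
Proof.
move=> cg hV eta0; have dpm := length_metric_pmetric.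
elim: s a => [|b s IH] a a0 /=.
  move=> _ a1 _; rewrite subrr; apply: le_trans (deps_le_dist _) _.
    by rewrite (pm_refl dpm) lee_fin; lra.
  by rewrite (pm_refl dpm).
move=> /andP[ab bs] l1 h; have b0 : 0 <= b by lra.
have bl : b <= last b s.
  by apply: (@itv_partition_le _ _ b (last b s) s); split.
have h1 := poly_length_var hV b0 bs l1.
have h2 : (d (g a) (g b) <= (V b - V a)%:E)%E by apply: hV; lra.
have -> : V (last b s) - V a = (V b - V a) + (V (last b s) - V b) by lra.
rewrite EFinD; apply: le_trans (deps_tri _ _ (g b) _ dpm) _; apply: leeD.
  apply: deps_length_arc => //; [lra|lra|].
  have := le_trans h (leeD (lexx _) h1).
  by rewrite -leeBlDr// -EFinB; congr (_ <= _)%E; congr EFin; lra.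
apply: IH => //; have := le_trans h (leeD h2 (lexx _)).
by rewrite -leeBlDl// -EFinB; congr (_ <= _)%E; congr EFin; lra.
Qed.

Lemma d0_length_metric x y :
  (d0 (length_metric d) x y <= length_metric d x y)%E.
Proof.
apply: ge_ereal_sup => _ [e /= e0 <-].
have [->|lf] := eqVneq (length_metric d x y) +oo%E; first by rewrite leey.
have lE : length_metric d x y = (fine (length_metric d x y))%:E.
  by rewrite fineK// ge0_fin_numE ?length_metric_ge0// ltey.
apply/lee_addgt0Pr => e' e'0.
have : (length_metric d x y < (fine (length_metric d x y) + e')%:E)%E.
  by rewrite {1}lE lte_fin; lra.
move=> /length_metric_lt[g [V [[cg g0 g1 hV] VL Ve]]].
(* Half of [e], because the chains of [deps_length_poly] have scale [2 * eta]. *)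
have eta0 : 0 < e / 2 by lra.
have [s [ps ls hs]] := Ve _ eta0.
have := @deps_length_poly g V _ 0 s cg hV eta0 (lexx _) ps.
rewrite ls (mulrC 2) divfK// => /(_ (lexx _) hs) h.
by rewrite g0 g1 in h; apply: le_trans h _; rewrite lE -EFinD lee_fin ltW.
Qed.

Lemma d0_iter_le_length_metric k x y :
  (d0_iter k d x y <= length_metric d x y)%E.
Proof.
elim: k x y => [|k IH] x y; first exact: le_length_metric.
apply: le_trans (d0_length_metric x y).
by apply: d0_le IH _ _; exact: length_metric_pmetric.
Qed.

End LengthMetricTheory.

(** * Length metrics under contractions and Lipschitz paths *)

Section LengthMetricMaps.
Context (R : realType).

Lemma length_metric_scale (X X' : Type) (r : X -> X -> \bar R) (r' : X' -> X' -> \bar R)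
    (phi : X -> X') (c : R) : 0 < c -> pmetric r -> pmetric r' ->
  (forall a b, (r' (phi a) (phi b) <= c%:E * r a b)%E) ->
  forall a b, (length_metric r' (phi a) (phi b) <= c%:E * length_metric r a b)%E.
Proof.
move=> c0 hr hr' h a b; rewrite -lee_pdivrMl//.
apply: length_metric_le_add => // g V [/continuous_pathP cg <- <- hV].
rewrite lee_pdivrMl// -EFinM mulrBr.
apply: (@route_le _ _ r' _ _ (phi \o g) (fun t => c * V t)); split => //.
  apply/continuous_pathP => t t0 t1 e e0.
  have ec0 : 0 < c^-1 * e by rewrite mulr_gt0// invr_gt0.
  have [d d0 hd] := cg t t0 t1 _ ec0; exists d => // s s0 s1 ts /=.
  by apply: le_lt_trans (h _ _) _; rewrite -lte_pdivlMl// -EFinM; exact: hd.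
move=> s t s0 st t1 /=; apply: le_trans (h _ _) _.
by rewrite -mulrBr EFinM lee_pmul2l// hV.
Qed.

Lemma length_metric_lipschitz (X : Type) (r : X -> X -> \bar R) (g : R -> X) (L : R) :
  pmetric r -> 0 <= L ->
  (forall s t, 0 <= s -> s <= t -> t <= 1 -> (r (g s) (g t) <= (L * (t - s))%:E)%E) ->
  (length_metric r (g 0%R) (g 1%R) <= L%:E)%E.
Proof.
move=> hr L0 h.
have -> : L = L * 1 - L * 0 by rewrite mulr1 mulr0 subr0.
apply: (@route_le _ _ r _ _ g (fun t => L * t)); split => //; last first.
  by move=> s t s0 st t1; rewrite -mulrBr; exact: h.
apply/continuous_pathP => t t0 t1 e e0.
have L1 : 0 < L + 1 by lra.
exists (e / (L + 1)); first by rewrite divr_gt0.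
move=> s s0 s1; rewrite ltr_pdivlMr// => ts.
have [le_ts|/ltW le_st] := lerP t s.
  apply: le_lt_trans (h _ _ _ _ _) _ => //; rewrite lte_fin.
  by move: ts; rewrite ler0_norm ?subr_le0//; nra.
rewrite (pm_sym hr); apply: le_lt_trans (h _ _ _ _ _) _ => //; rewrite lte_fin.
by move: ts; rewrite ger0_norm ?subr_ge0//; nra.
Qed.

End LengthMetricMaps.

(** * Test functions on a space glued from chains *)

Lemma small_eps (R : realType) (T : eqType) (s : seq T) (P : T -> R -> Prop) :
  (forall t, t \in s -> exists2 e, 0 < e & P t e) ->
  (forall t e e', P t e -> 0 < e' -> e' <= e -> P t e') ->
  exists2 e, 0 < e & forall t, t \in s -> P t e.
Proof.
move=> h mono; elim: s h => [|t s IH] h; first by exists 1.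
have [|e e0 he] := IH; first by move=> t' ht'; apply: h; rewrite inE ht' orbT.
have [|e' e'0 he'] := h t; first by rewrite inE eqxx.
have m0 : 0 < Num.min e e' by rewrite lt_min e0.
exists (Num.min e e') => // t'; rewrite inE => /predU1P[->|ht'].
  by apply: mono he' m0 _; rewrite ge_min lexx orbT.
by apply: mono (he _ ht') m0 _; rewrite ge_min lexx.
Qed.

(** McShane extension: [g b] is the minimum of 1 and of all [v a + trunc r 1 a b] with [a] in [s].
    Truncating at 1 keeps the terms real where [r] is infinite. *)
Lemma lip_extension (R : realType) (T : eqType) (r : T -> T -> \bar R)
    (s : seq T) (v : T -> R) : pmetric r ->
  (forall a, a \in s -> 0 <= v a <= 1) ->
  (forall a b, a \in s -> b \in s -> ((v b - v a)%:E <= r a b)%E) ->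
  exists g : T -> R, [/\ lip r g, forall a, 0 <= g a <= 1 &
    forall a, a \in s -> g a = v a].
Proof.
move=> hr v01 vlip; have t0 := trunc_ge0 hr (@ler01 R).
(* The last two clauses characterize this minimum, which is built up one point of [s] at a time. *)
have [g [glip g1 gle gge]] : exists g : T -> R, [/\ lip r g, forall a, g a <= 1,
    forall a b, a \in s -> g b <= v a + trunc r 1 a b &
    forall b w, w <= 1 -> (forall a, a \in s -> w <= v a + trunc r 1 a b) -> w <= g b].
  elim: s {v01 vlip} => [|c s [g [glip g1 gle gge]]].
    by exists (fun=> 1); split => // a b; rewrite subrr (pm_ge0 hr).
  exists (fun b => Num.min (v c + trunc r 1 c b) (g b)); split.
  - move=> a b; rewrite EFinB leeBlDr// {2}/Num.min; case: ifPn => _.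
      apply: (@le_trans _ _ (v c + trunc r 1 c b)%:E).
        by rewrite lee_fin ge_min lexx.
      have -> : v c + trunc r 1 c b =
          (trunc r 1 c b - trunc r 1 c a) + (v c + trunc r 1 c a) by lra.
      by rewrite EFinD leeD// trunc_lip.
    apply: (@le_trans _ _ (g b)%:E); first by rewrite lee_fin ge_min lexx orbT.
    by rewrite -leeBlDr// -EFinB.
  - by move=> a; rewrite ge_min g1 orbT.
  - move=> a b; rewrite inE => /predU1P[->|ha]; first by rewrite ge_min lexx.
    by rewrite ge_min gle ?orbT.
  - move=> b w w1 hw; rewrite le_min hw ?mem_head// gge// => a ha.
    by apply: hw; rewrite inE ha orbT.
exists g; split => //.
  move=> a; rewrite g1 andbT; apply: gge => // b /v01/andP[vb _].
  by rewrite addr_ge0.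
move=> a ha; apply/eqP; rewrite eq_le; apply/andP; split.
  by apply: le_trans (gle a a ha) _; rewrite (trunc_refl hr)// addr0.
have /andP[va0 va1] := v01 _ ha; apply: gge => // b hb.
rewrite -lerBlDl; apply: (trunc_ge hr) => //; last exact: vlip.
by have /andP[vb0 _] := v01 _ hb; lra.
Qed.

(** * Linear interpolation along a chain of copies *)

Section LinearChain.
Context (R : realType) (Y : bipointed R) (r : Y -> Y -> \bar R) (r_pm : pmetric r).
Context (c : R) (c0 : 0 < c) (r_pq : (c%:E <= r (pt_p Y) (pt_q Y))%E).
Context (n : nat) (vP vQ : R).

(** The [n.+1] copies are laid on [0, 1] as consecutive intervals of equal length. The position
    inside a copy is the distance from p, cut off at [c] and divided by [c]; since [r p q >= c], the
    point q lies at the right end. *)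
Definition linear_chain (j : nat) (a : Y) : R :=
  vP + (vQ - vP) * ((j%:R + trunc r c (pt_p Y) a / c) / n.+1%:R).

Lemma linear_chain_p j : linear_chain j (pt_p Y) = vP + (vQ - vP) * (j%:R / n.+1%:R).
Proof. by rewrite /linear_chain (trunc_refl r_pm (ltW c0)) mul0r addr0. Qed.

Lemma linear_chain_q j : linear_chain j (pt_q Y) = vP + (vQ - vP) * (j.+1%:R / n.+1%:R).
Proof. by rewrite /linear_chain (trunc_eq r_pm (ltW c0) r_pq) divff ?gt_eqF// natr1. Qed.

Lemma linear_chain_next j : linear_chain j (pt_q Y) = linear_chain j.+1 (pt_p Y).
Proof. by rewrite linear_chain_p linear_chain_q. Qed.

Lemma linear_chain0 : linear_chain 0 (pt_p Y) = vP.
Proof. by rewrite linear_chain_p mul0r mulr0 addr0. Qed.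

Lemma linear_chain_max : linear_chain n (pt_q Y) = vQ.
Proof. by rewrite linear_chain_q divff ?mulr1 ?pnatr_eq0// addrC subrK. Qed.

(** The factor [1 / n.+1] of the interpolation is the contraction of the copies, and the remaining
    slope [(vQ - vP) / c] is at most 1 in absolute value. *)
Lemma linear_chain_lip j : `|vQ - vP| <= c ->
  lip (fun a b => (n.+1%:R^-1)%:E * r a b)%E (linear_chain j).
Proof.
move=> hv a b.
have -> : linear_chain j b - linear_chain j a = n.+1%:R^-1 *
    ((vQ - vP) / c * (trunc r c (pt_p Y) b - trunc r c (pt_p Y) a)).
  by rewrite /linear_chain; ring.
rewrite EFinM lee_pmul2l ?lte_fin ?invr_gt0//.
apply: le_trans (trunc_dist_lip r_pm (ltW c0) (pt_p Y) a b).
rewrite lee_fin; apply: le_trans (ler_norm _) _; rewrite normrM.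
apply: ler_piMl => //; rewrite normrM normfV (gtr0_norm c0) ler_pdivrMr//.
by rewrite mul1r.
Qed.

Lemma linear_chain01 j a : (j <= n)%N -> 0 <= vP <= 1 -> 0 <= vQ <= 1 ->
  0 <= linear_chain j a <= 1.
Proof.
move=> jn /andP[p0 p1] /andP[q0 q1].
have t01 : 0 <= trunc r c (pt_p Y) a / c <= 1.
  apply/andP; split; first by rewrite divr_ge0 ?(trunc_ge0 r_pm (ltW c0)) ?ltW.
  by rewrite ler_pdivrMr// mul1r (trunc_le r_pm (ltW c0)).
rewrite /linear_chain; set t := (_ + _) / _.
have t0 : 0 <= t by rewrite /t divr_ge0// addr_ge0//; case/andP: t01.
have t1 : t <= 1.
  rewrite /t ler_pdivrMr// mul1r -natr1; apply: lerD; last by case/andP: t01.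
  by rewrite ler_nat.
by apply/andP; split; nra.
Qed.

End LinearChain.

(** * Transfer of Lipschitz bounds from the pieces to a glued space *)

Section ChainGluing.
Context (R : realType) (I : eqType) (Z : I -> bipointed R) (m : I -> nat).
Context (X : Type) (d : X -> X -> \bar R) (P Q : X).
Context (io : forall i, nat -> Z i -> X).

Definition piece_dist i (r : Z i -> Z i -> \bar R) a b : \bar R :=
  (((m i).+1%:R^-1)%:E * r a b)%E.

Definition joined (g : forall i, nat -> Z i -> R) (vP vQ : R) :=
  [/\ forall i, g i 0%N (pt_p (Z i)) = vP,
      forall i, g i (m i) (pt_q (Z i)) = vQ &
      forall i j, (j < m i)%N -> g i j (pt_q (Z i)) = g i j.+1 (pt_p (Z i))].

(* [X] is glued from chains [Z i, ..., Z i] of [(m i).+1] scaled copies, all of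
   them joining [P] to [Q]; [io i j] is the inclusion of the [j]-th copy. The
   metric of [X] enters only through its 1-Lipschitz functions. *)
Record chain_gluing : Prop := ChainGluing {
  cg_surj : forall x, exists i j (a : Z i), (j <= m i)%N /\ x = io j a;
  cg_p : forall i, io 0 (pt_p (Z i)) = P;
  cg_q : forall i, io (m i) (pt_q (Z i)) = Q;
  cg_next : forall i j, (j < m i)%N -> io j (pt_q (Z i)) = io j.+1 (pt_p (Z i));
  cg_univ : forall g vP vQ, joined g vP vQ ->
    exists f : X -> R, forall i j (a : Z i), (j <= m i)%N -> f (io j a) = g i j a;
  cg_lip : forall f : X -> R,
    (forall i j, (j <= m i)%N ->
       lip (piece_dist (@dist R (Z i))) (fun a => f (io j a))) -> lip d f;
  cg_pm : pmetric d;
  cg_pmZ : forall i, pmetric (@dist R (Z i));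
  cg_pq : forall i, (1%:E <= dist (pt_p (Z i)) (pt_q (Z i)))%E }.

Context (hX : chain_gluing).

Let rho k i := d0_iter k (@dist R (Z i)).

Let rho_pm k i : pmetric (rho k (i := i)).
Proof. exact: d0_iter_pmetric (cg_pmZ hX i). Qed.

Let rho_pq k i : (1%:E <= rho k (pt_p (Z i)) (pt_q (Z i)))%E.
Proof.
apply: le_trans (cg_pq hX i) _.
by apply: (@d0_iter_nondec _ _ 0%N) => //; exact: cg_pmZ.
Qed.

Lemma piece_dist_pmetric i (r : Z i -> Z i -> \bar R) :
  pmetric r -> pmetric (piece_dist r).
Proof. by apply: pmetric_scale; rewrite invr_ge0. Qed.

Lemma cg_ends (i : I) f g vP vQ : joined g vP vQ ->
  (forall i j (a : Z i), (j <= m i)%N -> f (io j a) = g i j a) ->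
  f P = vP /\ f Q = vQ.
Proof. by move=> [gp gq _] fg; rewrite -(cg_p hX i) -(cg_q hX i) !fg. Qed.

Let transfer k := forall f : X -> R, (forall x, 0 <= f x <= 1) ->
  (forall i j, (j <= m i)%N -> lip (piece_dist (rho k (i := i))) (fun a => f (io j a))) ->
  lip (d0_iter k d) f.

(* Clamping to a window of width [e] makes a function which is 1-Lipschitz at
   scale [e] globally 1-Lipschitz. *)
Lemma clamp_lip_at k f e : transfer k -> 0 < e ->
  (forall i j, (j <= m i)%N ->
     lip_at e (piece_dist (rho k (i := i))) (fun a => f (io j a))) ->
  exists2 e', 0 < e' & lip_at e' (d0_iter k d) f.
Proof.
(* [w <= 1] makes the clamped function eligible for [transfer]; [w <= e] makes its bound trivial on
   pairs further apart than [e]. The value at [x] is placed in the middle of the window. *)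
move=> hk e0 hf; pose w := Num.min e 1.
have w0 : 0 < w by rewrite lt_min e0 ltr01.
have we : w <= e by rewrite ge_min lexx.
have w1 : w <= 1 by rewrite ge_min lexx orbT.
exists (w / 4); first by rewrite divr_gt0.
move=> x y hxy.
pose g z := Num.max 0 (Num.min w (f z - f x + w / 2)).
have gw z : 0 <= g z <= w.
  by rewrite /g /Num.max /Num.min; case: ifPn; case: ifPn; lra.
have glip : lip (d0_iter k d) g.
  apply: hk => [z|i j jm a b]; first by have := gw z; lra.
  have [h|h] := leP (piece_dist (rho k (i := i)) a b) e%:E; last first.
    apply: le_trans (ltW h); rewrite lee_fin.
    by have := gw (io j a); have := gw (io j b); lra.
  have [hle|hlt] := leP (f (io j b)) (f (io j a)).
    apply: le_trans (pm_ge0 (piece_dist_pmetric (rho_pm k i)) _ _); rewrite lee_fin.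
    by rewrite /g /Num.max /Num.min; do 4 (case: ifPn); lra.
  apply: le_trans (hf i j jm a b h); rewrite lee_fin.
  by rewrite /g /Num.max /Num.min; do 4 (case: ifPn); lra.
have gx : g x = w / 2 by rewrite /g subrr /Num.max /Num.min; do 2 (case: ifPn); lra.
apply: le_trans (glip x y); rewrite lee_fin gx.
(* Hence [g y <= 3 * w / 4 < w]: the upper clamp is inactive at [y], and
   [f y - f x <= g y - g x]. *)
have : g y - g x <= w / 4 by rewrite -lee_fin; apply: le_trans (glip x y) hxy.
by rewrite gx /g /Num.max /Num.min; do 2 (case: ifPn); lra.
Qed.

(** Shrinking by [1 - eta] makes the Lipschitz inequalities strict where [f] increases, so each
    already holds for [deps] at some positive scale. Finitely many pairs and copies share a scale,
    at which the values on [s] are extended. *)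
Lemma approx_on_chain k i (s : seq (Z i)) (f : X -> R) (eta : R) :
  0 < eta -> eta < 1 -> (forall x, 0 <= f x <= 1) ->
  (forall j, (j <= m i)%N ->
     lip (piece_dist (rho k.+1 (i := i))) (fun a => f (io j a))) ->
  exists2 e, 0 < e & exists g : nat -> Z i -> R, forall j, (j <= m i)%N ->
   [/\ lip_at e (piece_dist (rho k (i := i))) (g j), forall a, 0 <= g j a <= 1 &
       forall a, a \in s -> g j a = (1 - eta) * f (io j a)].
Proof.
move=> eta0 eta1 f01 hf.
pose ok e j a b := (((1 - eta) * f (io j b) - (1 - eta) * f (io j a))%:E <=
  piece_dist (deps (rho k (i := i)) e) a b)%E.
have okmono j a b e e' : ok e j a b -> e' <= e -> ok e' j a b.
  move=> h ee'; apply: le_trans h _; apply: lee_wpmul2l; first by rewrite lee_fin invr_ge0.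
  exact: deps_anti.
have ok1 j a b : (j <= m i)%N -> exists2 e, 0 < e & ok e j a b.
  move=> jm; have [hle|hlt] := leP (f (io j b)) (f (io j a)).
    exists 1 => //; apply: (@le_trans _ _ 0%E); last first.
      by rewrite mule_ge0 ?lee_fin ?invr_ge0//; exact: deps_ge0 (rho_pm k i).
    by rewrite lee_fin -mulrBr; apply: mulr_ge0_le0; lra.
  have := hf j jm a b; rewrite /piece_dist -lee_pdivrMl ?invr_gt0// => h.
  have : (((m i).+1%:R^-1)^-1%:E * ((1 - eta) * f (io j b) - (1 - eta) * f (io j a))%:E <
      rho k.+1 a b)%E.
    apply: lt_le_trans h; rewrite -!EFinM lte_fin invrK ltr_pM2l//; nra.
  move=> /ereal_sup_gtP[_ [e /= e0 <-] he]; exists e => //.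
  by rewrite /ok /piece_dist -lee_pdivrMl ?invr_gt0// ltW.
have [e e0 he] : exists2 e, 0 < e & forall j, j \in iota 0 (m i).+1 ->
    forall a, a \in s -> forall b, b \in s -> ok e j a b.
  apply: small_eps => [j|t e e' h e'0 ee' a ha b hb]; last by apply: okmono (h a ha b hb) ee'.
  rewrite mem_iota add0n ltnS => /andP[_ jm].
  apply: (small_eps (P := fun a e => forall b, b \in s -> ok e j a b)) => [a _|t e e' h e'0 ee' b hb];
    last by apply: okmono (h b hb) ee'.
  apply: (small_eps (P := fun b e => ok e j a b)) => [b _|t e e' h e'0 ee'];
    last by apply: okmono h ee'.
  exact: ok1.
have m0 : 0 < (m i).+1%:R :> R by [].
(* A scaled distance of at most [e / (m i).+1] is an unscaled one of at most [e], and there [deps]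
   is bounded by the distance itself. *)
exists (e / (m i).+1%:R); first by rewrite divr_gt0.
have H j : exists g : Z i -> R, (j <= m i)%N ->
   [/\ lip_at (e / (m i).+1%:R) (piece_dist (rho k (i := i))) g, forall a, 0 <= g a <= 1 &
       forall a, a \in s -> g a = (1 - eta) * f (io j a)].
  have [jm|_] := boolP (j <= m i)%N; last by exists (fun=> 0).
  have := @lip_extension R (Z i) (piece_dist (deps (rho k (i := i)) e)) s
    (fun a => (1 - eta) * f (io j a)).
  case.
  - by apply: piece_dist_pmetric; exact: deps_pmetric.
  - by move=> a _; have := f01 (io j a); nra.
  - by move=> a b ha hb; apply: he => //; rewrite mem_iota add0n ltnS.
  move=> g [glip g01 gs]; exists g => _; split => // a b hab.
  apply: le_trans (glip a b) _; apply: lee_wpmul2l; first by rewrite lee_fin invr_ge0.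
  apply: deps_le_dist; move: hab; rewrite /piece_dist -lee_pdivlMl ?invr_gt0//.
  by rewrite -EFinM invrK mulrC divfK// gt_eqF.
exists (fun j => projT1 (cid (H j))) => j jm.
exact: projT2 (cid (H j)) jm.
Qed.

Lemma transferS k : transfer k -> transfer k.+1.
Proof.
move=> hk f f01 hf x y.
have [ix [jx [a [jxm ->]]]] := cg_surj hX x.
have [iy [jy [b [jym ->]]]] := cg_surj hX y.
set x' := io jx a; set y' := io jy b.
(* The list holding [c] on the chain [i0] and nothing on the others; the equality of indices
   transports [c] to the type [Z i]. *)
pose at_ i0 (c : Z i0) i : seq (Z i) :=
  if pselect (i0 = i) is left e then [:: eq_rect i0 (fun i => Z i : Type) c i e] else [::].
have at_in i0 (c : Z i0) : c \in at_ i0 c i0.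
  rewrite /at_; case: pselect => // e.
  by rewrite (Prop_irrelevance e (erefl _)) /= mem_head.
(* With p and q among the prescribed points, the extensions on consecutive copies agree where these
   are glued. *)
pose s i := [:: pt_p (Z i), pt_q (Z i) & at_ ix a i ++ at_ iy b i].
have approx eta : 0 < eta -> eta < 1 ->
    (((1 - eta) * (f y' - f x'))%:E <= d0_iter k.+1 d x' y')%E.
  move=> eta0 eta1.
  pose good i e := exists g : nat -> Z i -> R, forall j, (j <= m i)%N ->
    [/\ lip_at e (piece_dist (rho k (i := i))) (g j), forall a, 0 <= g j a <= 1 &
       forall a, a \in s i -> g j a = (1 - eta) * f (io j a)].
  have [e e0 he] : exists2 e, 0 < e & forall i, i \in [:: ix; iy] -> good i e.
    apply: small_eps => [i _|i e e' [g hg] e'0 ee'];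
      first exact: (approx_on_chain (s i) eta0 eta1 f01 (hf i)).
    exists g => j jm; have [h1 h2 h3] := hg j jm; split => // c c' hc.
    by apply: h1; apply: le_trans hc _; rewrite lee_fin.
  have fP := f01 P; have fQ := f01 Q.
  pose approximant i (g : nat -> Z i -> R) :=
    [/\ forall j, (j <= m i)%N -> lip_at e (piece_dist (rho k (i := i))) (g j),
        forall j c, (j <= m i)%N -> 0 <= g j c <= 1,
        i \in [:: ix; iy] -> forall j c, (j <= m i)%N -> c \in s i ->
          g j c = (1 - eta) * f (io j c) &
        [/\ g 0%N (pt_p (Z i)) = (1 - eta) * f P,
            g (m i) (pt_q (Z i)) = (1 - eta) * f Q &
            forall j, (j < m i)%N -> g j (pt_q (Z i)) = g j.+1 (pt_p (Z i))]].
  have H i : exists g, approximant i g.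
    have [hi|hi] := boolP (i \in [:: ix; iy]).
      have [g hg] := he i hi; exists g.
      have gs j c : (j <= m i)%N -> c \in s i -> g j c = (1 - eta) * f (io j c).
        by move=> jm; have [_ _] := hg j jm; apply.
      have ps : pt_p (Z i) \in s i by rewrite inE eqxx.
      have qs : pt_q (Z i) \in s i by rewrite !inE eqxx orbT.
      split => //.
      + by move=> j jm; have [] := hg j jm.
      + by move=> j c jm; have [_ + _] := hg j jm; apply.
      split; rewrite ?gs// ?(cg_p hX) ?(cg_q hX)// => j jm.
      by rewrite (gs j _ (ltnW jm) qs) (gs j.+1 _ jm ps) (cg_next hX).
    (* On a chain containing neither chosen point only the end values matter, and they differ by at
       most 1, a lower bound for [rho k p q]. *)
    exists (linear_chain (rho k (i := i)) 1 (m i) ((1 - eta) * f P) ((1 - eta) * f Q)).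
    split => //.
    + move=> j jm; apply: lip_lip_at; apply: linear_chain_lip => //.
      by rewrite ler_norml; nra.
    + by move=> j c jm; apply: linear_chain01 => //; nra.
    + by rewrite (negbTE hi).
    split; rewrite ?linear_chain0 ?linear_chain_max// => j jm.
    exact: linear_chain_next.
  have [G hG] : exists G, forall i, approximant i (G i).
    by exists (fun i => projT1 (cid (H i))) => i; exact: projT2 (cid (H i)).
  have [|f' hf'] := @cg_univ hX G ((1 - eta) * f P) ((1 - eta) * f Q).
    by split=> i; have [_ _ _ []] := hG i.
  have f'x : f' x' = (1 - eta) * f x'.
    rewrite hf'//; have [_ _ hs _] := hG ix.
    by rewrite hs// ?inE ?eqxx// mem_cat at_in !orbT.
  have f'y : f' y' = (1 - eta) * f y'.
    rewrite hf'//; have [_ _ hs _] := hG iy.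
    by rewrite hs// ?inE ?eqxx ?orbT// mem_cat at_in !orbT.
  have [|e' e'0 he'] := @clamp_lip_at k f' e hk e0.
    move=> i j jm c c' hc; rewrite !hf'//.
    by have [+ _ _ _] := hG i; apply.
  rewrite mulrBr -f'x -f'y; apply: lip_at_d0 e'0 _ he' _ _.
  exact: d0_iter_pmetric (cg_pm hX).
have [h|hfin] := eqVneq (d0_iter k.+1 d x' y') +oo%E; first by rewrite h leey.
(* Since [f] is [0, 1]-valued, undoing the shrinking costs at most [eta <= e]. *)
apply/lee_addgt0Pr => e e0; pose eta := Num.min e (1 / 2).
have eta0 : 0 < eta by rewrite lt_min e0; lra.
have etae : eta <= e by rewrite ge_min lexx.
have eta2 : eta <= 1 / 2 by rewrite ge_min lexx orbT.
have eta1 : eta < 1 by lra.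
have h := approx _ eta0 eta1; apply: le_trans (leeD h (lexx e%:E)); rewrite -EFinD lee_fin.
by have := f01 x'; have := f01 y'; nra.
Qed.

Theorem chain_gluing_lip k (f : X -> R) : (forall x, 0 <= f x <= 1) ->
  (forall i j, (j <= m i)%N ->
     lip (piece_dist (d0_iter k (@dist R (Z i)))) (fun a => f (io j a))) ->
  lip (d0_iter k d) f.
Proof.
elim: k f => [|k IH] f; last exact: transferS IH f.
by move=> _; exact: (cg_lip hX).
Qed.

(** Clamping disposes of both the range of [f] and the restriction to scale [e], but yields only a
    local bound for [d0^k]; one more iteration makes it global. *)
Theorem chain_gluing_lip_at k (f : X -> R) (e : R) : 0 < e ->
  (forall i j, (j <= m i)%N ->
     lip_at e (piece_dist (d0_iter k (@dist R (Z i)))) (fun a => f (io j a))) ->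
  lip (d0_iter k.+1 d) f.
Proof.
move=> e0 hf; have [e' e'0 he'] := clamp_lip_at (@chain_gluing_lip k) e0 hf.
exact: lip_at_d0 e'0 (d0_iter_pmetric _ (cg_pm hX)) he'.
Qed.

Lemma linear_joined k vP vQ : joined
  (fun i => linear_chain (d0_iter k (@dist R (Z i))) 1 (m i) vP vQ) vP vQ.
Proof.
split=> i; [apply: linear_chain0|apply: linear_chain_max|move=> j _;
  apply: linear_chain_next] => //; by [exact: rho_pm|exact: rho_pq].
Qed.

Lemma cg_dist_pq (i : I) : (1%:E <= d P Q)%E.
Proof.
have [f hf] := cg_univ hX (linear_joined 0 0 1).
have [fP fQ] := cg_ends i (linear_joined 0 0 1) hf.
have : lip d f.
  apply: (cg_lip hX) => i' j jm a b; rewrite !hf//.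
  by apply: linear_chain_lip => //; rewrite ?subr0 ?normr1//; exact: cg_pmZ.
by move=> /(_ P Q); rewrite fP fQ subr0.
Qed.

End ChainGluing.

(** * The gluing construction *)

Section QuotientLift.
Context (T : choiceType) (r : T -> T -> Prop).

Lemma gen_classP x y : gen_class r x = gen_class r y <->
  Relation_Operators.clos_refl_sym_trans T r x y.
Proof.
split=> [/eqquotP/asboolP //|h].
by rewrite /gen_class; apply/eqquotP; apply/asboolP.
Qed.

Lemma gen_class_eq x y : r x y -> gen_class r x = gen_class r y.
Proof. by move=> h; apply/gen_classP; exact: Relation_Operators.rst_step. Qed.

Lemma gen_class_surj z : exists x, z = gen_class r x.
Proof. by exists (generic_quotient.repr z); rewrite /gen_class generic_quotient.reprK. Qed.

(** The lift evaluates [g] at a representative; invariance under [r] propagates through the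
    generated equivalence. *)
Lemma gen_quot_lift (U : Type) (g : T -> U) : (forall x y, r x y -> g x = g y) ->
  exists f : gen_quot r -> U, forall x, f (gen_class r x) = g x.
Proof.
move=> hg; exists (fun z => g (generic_quotient.repr z)) => x.
have hg' u v : Relation_Operators.clos_refl_sym_trans T r u v -> g u = g v.
  by elim=> [? ? /hg|//|? ? _ ->|? ? ? _ -> _ ->].
have : gen_class r (generic_quotient.repr (gen_class r x)) = gen_class r x.
  by rewrite /gen_class generic_quotient.reprK.
by move=> /gen_classP/hg'.
Qed.

End QuotientLift.

Section GlueInstance.
Context (R : realType) (Y : bipointed R) (Y_pm : pmetric (@dist R Y)).

(** A natural number as copy index avoids dependent types; an index above [i] falls back to the
    first copy, so statements carry [j <= i]. *)
Definition glue_io (i j : nat) (a : Y) : glue Y := glue_pt (inord j : 'I_i.+1) a.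

Lemma glue_pt_io i (j : 'I_i.+1) a : glue_pt j a = glue_io i j a.
Proof. by rewrite /glue_io inord_val. Qed.

Lemma hop_cost_ge0 (h : hop Y) : (0 <= hop_cost h)%E.
Proof. by rewrite mule_ge0 ?lee_fin ?invr_ge0// (pm_ge0 Y_pm). Qed.

Lemma glue_surj (x : glue Y) : exists i j a, (j <= i)%N /\ x = glue_io i j a.
Proof.
have [[i [j a]] ->] := gen_class_surj x.
by exists i, j, a; split; [rewrite -ltnS|rewrite -glue_pt_io].
Qed.

Lemma glue_io_dist i j a b : (dist (glue_io i j a) (glue_io i j b) <=
  (i.+1%:R^-1)%:E * dist a b)%E.
Proof.
apply: ge_ereal_inf; exists (hop_cost (@Hop R Y i (inord j) a b)) => //.
exists 1%N, (fun=> @Hop R Y i (inord j) a b); split; first by split.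
by rewrite big_nat1.
Qed.

Lemma glue_dist_sym_le (x y : glue Y) : (glue_dist y x <= glue_dist x y)%E.
Proof.
apply: ereal_inf_le_tmp => _ [k [h [[k0 h0 hk hl] ->]]].
pose swap (u : hop Y) := Hop (hop_j u) (hop_b u) (hop_a u).
exists k, (fun i => swap (h (k.-1 - i)%N)); split.
  split => //; rewrite ?subn0 ?subnn//.
  move=> i ik; have ik' : (i < k.-1)%N by rewrite -ltnS prednK.
  have -> : hop_tgt (swap (h (k.-1 - i)%N)) = hop_src (h (k.-1 - i)%N) by [].
  have -> : hop_src (swap (h (k.-1 - i.+1)%N)) = hop_tgt (h (k.-1 - i.+1)%N) by [].
  by rewrite -(subnSK ik') hl// subnSK// (leq_ltn_trans (leq_subr _ _))// prednK.
rewrite big_nat_rev /= add0n !big_nat; apply: eq_bigr => i /andP[_ ik].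
by rewrite /hop_cost /= (pm_sym Y_pm) -subn1 -subnDA add1n.
Qed.

Lemma glue_dist_tri (x y z : glue Y) :
  (glue_dist x z <= glue_dist x y + glue_dist y z)%E.
Proof.
apply: le_ereal_infD.
- by move=> _ [k [h [_ ->]]]; apply: sume_ge0 => *; exact: hop_cost_ge0.
- by move=> _ [k [h [_ ->]]]; apply: sume_ge0 => *; exact: hop_cost_ge0.
move=> _ _ [k [h [[k0 h0 hk hl] ->]]] [k' [h' [[k'0 h'0 h'k h'l] ->]]].
pose u i := if (i < k)%N then h i else h' (i - k)%N.
have ul i : (i < k)%N -> u i = h i by rewrite /u => ->.
have ur i : u (i + k)%N = h' i by rewrite /u ltnNge leq_addl /= addnK.
apply: ge_ereal_inf; exists (\sum_(0 <= i < k' + k) hop_cost (u i))%E; last first.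
  rewrite (@big_cat_nat _ _ _ k)//= ?leq_addl// leeD//.
    by rewrite !big_nat; apply: lee_sum => i /andP[_ ik]; rewrite ul.
  rewrite -{1}[k]add0n big_addn addnK; apply: lee_sum => i _.
  by rewrite ur.
exists (k' + k)%N, u; split => //; split.
- by rewrite addn_gt0 k0 orbT.
- by rewrite ul.
- have -> : (k' + k).-1 = (k'.-1 + k)%N by case: k' k'0 {h'k h'l}.
  by rewrite ur.
move=> i; case: (ltnP i.+1 k) => [ik _|]; first by rewrite !ul ?(ltnW ik)//; exact: hl.
rewrite leq_eqVlt => /predU1P[ki _|ki ik].
  have -> : u i.+1 = h' 0%N by rewrite -ki -[k in u k]add0n ur.
  by rewrite ul ?ki// h'0 -hk ki.
have ki' : (k <= i)%N by [].
rewrite -(subnK ki') -addSn !ur; apply: h'l.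
by rewrite -subSn// ltn_subLR; [rewrite addnC|rewrite ltnW].
Qed.

Lemma glue_pmetric : pmetric (@dist R (glue Y)).
Proof.
split; [|by move=> *; apply/eqP; rewrite eq_le !glue_dist_sym_le|exact: glue_dist_tri|].
  move=> x; apply/eqP; rewrite eq_le; apply/andP; split.
    have [i [j [a [_ ->]]]] := glue_surj x.
    by apply: le_trans (glue_io_dist _ _ _ _) _; rewrite (pm_refl Y_pm) mule0.
  by apply: le_ereal_inf_tmp => _ [k [h [_ ->]]]; apply: sume_ge0 => *; exact: hop_cost_ge0.
move=> x y.
by apply: le_ereal_inf_tmp => _ [k [h [_ ->]]]; apply: sume_ge0 => *; exact: hop_cost_ge0.
Qed.

Lemma glue_io_p i : glue_io i 0 (pt_p Y) = pt_p (glue Y).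
Proof.
apply: gen_class_eq; rewrite (_ : inord 0 = ord0); last by apply/val_inj; rewrite /= inordK.
exact: glued_p.
Qed.

Lemma glue_io_q i : glue_io i i (pt_q Y) = pt_q (glue Y).
Proof.
apply: gen_class_eq; rewrite (_ : inord i = ord_max); last by apply/val_inj; rewrite /= inordK.
(* The point q of the gluing is written with [ord0], whereas [glued_q] speaks of [ord_max]. *)
have e : ord0 = ord_max :> 'I_1 by exact/val_inj.
rewrite [X in glued _ X](_ : _ = piece (ord_max : 'I_1) (pt_q Y)); last by rewrite e.
exact: glued_q.
Qed.

Lemma glue_io_next i j : (j < i)%N -> glue_io i j (pt_q Y) = glue_io i j.+1 (pt_p Y).
Proof.
move=> ji; apply: gen_class_eq; apply: glued_next.
by rewrite !inordK// ltnS ltnW.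
Qed.

(** Each hop stays inside one piece, and the increments of [f] telescope along a hop chain. *)
Lemma glue_lip (f : glue Y -> R) :
  (forall i j, (j <= i)%N -> lip (fun a b => (i.+1%:R^-1)%:E * dist a b)%E
     (fun a => f (glue_io i j a))) -> lip (@dist R (glue Y)) f.
Proof.
move=> hf x y; apply: le_ereal_inf_tmp => _ [k [h [[k0 <- <- hl] ->]]].
have hop1 u : ((f (hop_tgt u) - f (hop_src u))%:E <= hop_cost u)%E.
  by rewrite /hop_tgt /hop_src !glue_pt_io; apply: hf; rewrite -ltnS.
case: k hl k0 => // k hl _ /=; elim: k hl => [|k IH] hl; first by rewrite big_nat1.
rewrite big_nat_recr//=.
have -> : f (hop_tgt (h k.+1)) - f (hop_src (h 0%N)) =
    (f (hop_tgt (h k)) - f (hop_src (h 0%N))) +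
    (f (hop_tgt (h k.+1)) - f (hop_src (h k.+1))).
  by rewrite (hl k)//; lra.
by rewrite EFinD leeD// IH// => i ik; apply: hl; rewrite ltnW.
Qed.

Lemma glue_chain_gluing : (1%:E <= dist (pt_p Y) (pt_q Y))%E ->
  chain_gluing (Z := fun _ : nat => Y) id (@dist R (glue Y))
    (pt_p (glue Y)) (pt_q (glue Y)) glue_io.
Proof.
move=> Y_pq; split => //.
- exact: glue_surj.
- exact: glue_io_p.
- exact: glue_io_q.
- exact: glue_io_next.
- move=> g vP vQ [gp gq gn].
  pose G (z : pieces Y) := g (projT1 z) (projT2 z).1 (projT2 z).2.
  have [f hf] : exists f : glue Y -> R, forall z, f (gen_class (@glued R Y) z) = G z.
    apply: gen_quot_lift => _ _ [i j j' jj'|i i'|i i']; rewrite /G /=.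
    - by rewrite jj' gn// -jj' -ltnS.
    - by rewrite !gp.
    - by rewrite !gq.
  exists f => i j a ji; rewrite /glue_io hf /G /= inordK//.
- exact: glue_lip.
- exact: glue_pmetric.
Qed.

End GlueInstance.

(** * The space Y_1 *)

Section FirstSpace.
Context (R : realType).

Lemma linf_dist_ge (x y : nat -> R) i : (`|x i - y i|%:E <= linf_dist x y)%E.
Proof. by apply: ereal_sup_ubound; exists i. Qed.

Lemma linf_dist_le (x y : nat -> R) (b : \bar R) :
  (forall i, (`|x i - y i|%:E <= b)%E) -> (linf_dist x y <= b)%E.
Proof. by move=> h; apply: ge_ereal_sup => _ [i _ <-]. Qed.

Lemma linf_pmetric : pmetric (@linf_dist R).
Proof.
have ge0 (x y : nat -> R) : (0 <= linf_dist x y)%E.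
  by apply: le_trans (linf_dist_ge x y 0); rewrite lee_fin.
split=> //.
- move=> x; apply/eqP; rewrite eq_le ge0 andbT.
  by apply: linf_dist_le => i; rewrite subrr normr0.
- by move=> x y; rewrite /linf_dist; congr ereal_sup; apply: eq_imagel => i _; rewrite distrC.
- move=> x y z; apply: linf_dist_le => i.
  apply: le_trans (leeD (linf_dist_ge x y i) (linf_dist_ge y z i)).
  by rewrite -EFinD lee_fin -(subrKA (y i)) ler_normD.
Qed.

Lemma Y1_pmetric : pmetric (@dist R (Y1 R)).
Proof.
split=> [x|x y|x y z|x y]; [exact: pm_refl linf_pmetric _|exact: pm_sym linf_pmetric _ _|
  exact: pm_tri linf_pmetric _ _ _|exact: pm_ge0 linf_pmetric _ _].
Qed.

Lemma linf_vec_le k (s t s' t' b : R) : `|s - s'| <= b -> `|t - t'| <= b ->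
  (linf_dist (vec k s t) (vec k s' t') <= b%:E)%E.
Proof.
move=> hs ht; apply: linf_dist_le => i; rewrite lee_fin /vec.
case: ifP => // _; case: ifP => // _; rewrite subrr normr0.
exact: le_trans hs.
Qed.

Lemma linf_vec_ge1 k k' (s t s' t' b : R) :
  (linf_dist (vec k s t) (vec k' s' t') <= b%:E)%E -> `|s - s'| <= b.
Proof.
by move=> h; rewrite -lee_fin; apply: le_trans h; apply: le_trans (linf_dist_ge _ _ 0).
Qed.

Lemma linf_vec_ge2 k (s t s' t' b : R) : (2 <= k)%N ->
  (linf_dist (vec k s t) (vec k s' t') <= b%:E)%E -> `|t - t'| <= b.
Proof.
move=> k2 h; rewrite -lee_fin; apply: le_trans h.
apply: le_trans (linf_dist_ge _ _ k.-1).
by rewrite /vec eqxx ifF//; case: k k2 => [|[]].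
Qed.

Lemma linf_vec_ge_other k k' (s t s' t' b : R) : (2 <= k)%N -> k != k' ->
  (linf_dist (vec k s t) (vec k' s' t') <= b%:E)%E -> `|t| <= b.
Proof.
move=> k2 kk' h; rewrite -lee_fin; apply: le_trans h.
apply: le_trans (linf_dist_ge _ _ k.-1).
rewrite /vec eqxx; case: k k2 kk' => [|[|k]]//= _ kk'.
case: k' kk' => [|k'] /=; first by rewrite subr0.
by rewrite eqSS => /negPf ->; rewrite subr0.
Qed.

(* [Y1_coord k s t up]: the point [vec k s t] belongs to the first two sides of
   S_k ([up]) or to the third one; the point p is filed under [k = 0]. *)
Inductive Y1_coord : nat -> R -> R -> bool -> Prop :=
| coord_p : Y1_coord 0 0 0 false
| coord_side1 k t : (2 <= k)%N -> 0 <= t <= 1 -> Y1_coord k 1 t true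
| coord_side2 k s : (2 <= k)%N -> k%:R^-1 <= s <= 1 -> Y1_coord k s 1 true
| coord_side3 k t : (2 <= k)%N -> 0 <= t <= 1 -> Y1_coord k k%:R^-1 t false.

Lemma Y1_coordP (z : Y1 R) : exists c : nat * R * R * bool,
  Y1_coord c.1.1.1 c.1.1.2 c.1.2 c.2 /\ val z = vec c.1.1.1 c.1.1.2 c.1.2.
Proof.
case: z => z /= zY; case: (set_mem zY) => [->|[k k2 [[]|]]].
- exists (0%N, 0, 0, false); split; first exact: coord_p.
  by apply/funext => i; rewrite /Y1_p /vec /=; case: ifP => //; rewrite if_same.
- move=> [t] /=; rewrite in_itv /= => t01 <-.
  by exists (k, 1, t, true); split => //; exact: coord_side1.
- move=> [s] /=; rewrite in_itv /= => s01 <-.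
  by exists (k, s, 1, true); split => //; exact: coord_side2.
- move=> [t] /=; rewrite in_itv /= => t01 <-.
  by exists (k, k%:R^-1, t, false); split => //; exact: coord_side3.
Qed.

Lemma inv_nat_le2 k : (2 <= k)%N -> 0 < k%:R^-1 :> R /\ k%:R^-1 <= 1 / 2 :> R.
Proof.
move=> k2; have k0 : 0 < k%:R :> R by rewrite ltr0n (leq_trans _ k2).
split; first by rewrite invr_gt0.
by rewrite div1r lef_pV2 ?posrE// ler_nat.
Qed.

(** Sequences outside [Y1_set] are sent to p, so that paths can be written as formulas in
    sequences. *)
Definition to_Y1 (v : nat -> R) : Y1 R :=
  if pselect (Y1_set v) is left h then exist _ v (mem_set h) else pt_p (Y1 R).

Lemma to_Y1K v : Y1_set v -> val (to_Y1 v) = v.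
Proof. by rewrite /to_Y1; case: pselect. Qed.

(* Arc-length parametrization of S_k from q. *)
Definition S_path (k : nat) (u : R) : nat -> R :=
  vec k (Num.max k%:R^-1 (Num.min 1 (2 - u)))
        (Num.min (Num.min u 1) (3 - k%:R^-1 - u)).

Lemma S_path_in k u : (2 <= k)%N -> 0 <= u -> u <= 3 - k%:R^-1 -> Y1_set (S_path k u).
Proof.
move=> k2 u0 u3; have [i0 i2] := inv_nat_le2 k2.
right; exists k => //; rewrite /S_path.
have [u1|u1] := leP u 1.
  left; left; exists u; first by rewrite /= in_itv /= u0.
  by congr vec; rewrite /Num.max /Num.min; do ?case: ifPn; lra.
have [v2|v2] := leP u (2 - k%:R^-1).
  left; right; exists (2 - u); first by rewrite /= in_itv /=; lra.
  by congr vec; rewrite /Num.max /Num.min; do ?case: ifPn; lra.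
right; exists (3 - k%:R^-1 - u); first by rewrite /= in_itv /=; lra.
by congr vec; rewrite /Num.max /Num.min; do ?case: ifPn; lra.
Qed.

Lemma S_path_dist k u v b : `|u - v| <= b ->
  (linf_dist (S_path k u) (S_path k v) <= b%:E)%E.
Proof.
rewrite ler_norml => uv.
apply: linf_vec_le; rewrite ler_norml /Num.max /Num.min; do ?case: ifPn; lra.
Qed.

Lemma S_path_length k u v : (2 <= k)%N -> 0 <= u -> u <= 3 - k%:R^-1 ->
  0 <= v -> v <= 3 - k%:R^-1 ->
  (length_metric (@dist R (Y1 R)) (to_Y1 (S_path k u)) (to_Y1 (S_path k v)) <=
   `|v - u|%:E)%E.
Proof.
move=> k2 u0 u3 v0 v3; pose g (t : R) := to_Y1 (S_path k (u + t * (v - u))).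
have -> : to_Y1 (S_path k u) = g 0 by rewrite /g mul0r addr0.
have -> : to_Y1 (S_path k v) = g 1 by rewrite /g mul1r addrC subrK.
apply: length_metric_lipschitz => //; first exact: Y1_pmetric.
move=> s t s0 st t1.
have inS w : 0 <= w -> w <= 1 -> Y1_set (S_path k (u + w * (v - u))).
  by move=> w0 w1; apply: S_path_in => //; nra.
rewrite /dist /= /g !to_Y1K; [|by apply: inS; lra|by apply: inS; lra].
apply: S_path_dist.
have -> : u + s * (v - u) - (u + t * (v - u)) = (s - t) * (v - u) by ring.
by rewrite normrM mulrC ler_wpM2l// distrC ger0_norm; lra.
Qed.

Lemma S_path0 k : (2 <= k)%N -> to_Y1 (S_path k 0) = pt_q (Y1 R).
Proof.
move=> k2; have [i0 i2] := inv_nat_le2 k2.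
apply: val_inj; rewrite to_Y1K; last by apply: S_path_in => //; lra.
apply/funext => i; rewrite /= /Y1_q /S_path /vec; case: ifP => _.
  by rewrite /Num.max /Num.min; do ?case: ifPn; lra.
by case: ifP => // _; rewrite /Num.min; do ?case: ifPn; lra.
Qed.

(** Arc length from q to [vec k s t] along S_k. The coordinates (0, 0) of p give 3, the limit of the
    lengths [3 - 1/k] of the S_k. *)
Definition arc (s t : R) (up : bool) : R := if up then t + (1 - s) else 2 - t + (1 - s).

Lemma arc_path k s t up : Y1_coord k s t up -> (2 <= k)%N ->
  [/\ 0 <= arc s t up, arc s t up <= 3 - k%:R^-1 & S_path k (arc s t up) = vec k s t].
Proof.
case=> // {}k v k2 v01 _; have [i0 i2] := inv_nat_le2 k2.
- by rewrite /arc; split; [lra|lra|congr vec; rewrite /Num.max /Num.min; do ?case: ifPn; lra].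
- by rewrite /arc; split; [lra|lra|congr vec; rewrite /Num.max /Num.min; do ?case: ifPn; lra].
- by rewrite /arc; split; [lra|lra|congr vec; rewrite /Num.max /Num.min; do ?case: ifPn; lra].
Qed.

(* [arc], made constant on the [e]-neighbourhoods of q and of the corners,
   where the chords of S_k are shorter than its arcs. *)
Definition squash (e t : R) : R := Num.max e (Num.min t (1 - e)) - e.

(** As [squash e 1 = 1 - 2 * e], the two branches agree at the corner [t = 1]. *)
Definition arc_e (e s t : R) (up : bool) : R :=
  if up then squash e t + (1 - s) else 2 * (1 - 2 * e) - squash e t + (1 - s).

Lemma squash_bounds e t : 0 < e -> e < 1 / 4 -> 0 <= t <= 1 ->
  t - 2 * e <= squash e t <= t.
Proof. by move=> e0 e4 t01; rewrite /squash /Num.max /Num.min; do ?case: ifPn; lra. Qed.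

Lemma squash_lip e t t' : `|squash e t - squash e t'| <= `|t - t'|.
Proof.
have := ler_norm (t - t'); have := ler_norm (t' - t); rewrite (distrC t') ler_norml.
by rewrite /squash /Num.max /Num.min; do ?case: ifPn; lra.
Qed.

Lemma squash0 e t : e < 1 / 4 -> t <= e -> squash e t = 0.
Proof. by move=> e4 te; rewrite /squash /Num.max /Num.min; do ?case: ifPn; lra. Qed.

Lemma squash1 e t : e < 1 / 4 -> 1 - e <= t -> squash e t = 1 - 2 * e.
Proof. by move=> e4 te; rewrite /squash /Num.max /Num.min; do ?case: ifPn; lra. Qed.

Lemma arc_e_bounds e k s t up : 0 < e -> e < 1 / 4 -> Y1_coord k s t up ->
  arc s t up - 4 * e <= arc_e e s t up <= arc s t up.
Proof.
move=> e0 e4 hc; have t01 : 0 <= t <= 1 by case: hc => *; lra.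
by have := squash_bounds e0 e4 t01; rewrite /arc /arc_e; case: up {hc}; lra.
Qed.

Lemma Y1_coord_facts k s t up : Y1_coord k s t up -> (2 <= k)%N ->
  [/\ 0 <= t <= 1, k%:R^-1 <= s <= 1 & if up then s = 1 \/ t = 1 else s = k%:R^-1].
Proof.
by case=> // {}k v k2 v01 _; have [i0 i2] := inv_nat_le2 k2; split => //;
  by [lra|left|right].
Qed.

(** If the two points lie on different sides, they are near a common corner, where both values of
    [squash] are [1 - 2 * e] and only the first coordinate contributes. *)
Lemma arc_e_same e D k s t up s' t' up' : 0 < e -> e < 1 / 4 -> D <= e ->
  (2 <= k)%N -> Y1_coord k s t up -> Y1_coord k s' t' up' ->
  `|s - s'| <= D -> `|t - t'| <= D -> `|arc_e e s t up - arc_e e s' t' up'| <= D.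
Proof.
move=> e0 e4 De k2 h h' hs ht.
have sl := le_trans (squash_lip e t t') ht.
have [i0 i2] := inv_nat_le2 k2.
have [t01 s01 hup] := Y1_coord_facts h k2; have [t01' s01' hup'] := Y1_coord_facts h' k2.
have c1 := @squash1 e t e4; have c1' := @squash1 e t' e4.
move: hs ht sl; rewrite !ler_norml /arc_e => hs ht sl.
case: up hup {h} => [[]|] hup; case: up' hup' {h'} => [[]|] hup'; try lra;
  by rewrite c1 ?c1'; lra.
Qed.

(** Both second coordinates are at most [e], so [squash] vanishes. The first coordinate is then 1
    (near q) or at most 1/2 (bottom of a third side, or p), which separates the two cases. *)
Lemma arc_e_other e D k s t up k' s' t' up' : 0 < e -> e < 1 / 4 -> D <= e ->
  Y1_coord k s t up -> Y1_coord k' s' t' up' ->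
  `|s - s'| <= D -> `|t| <= D -> `|t'| <= D ->
  [/\ up = up', `|arc_e e s t up - arc_e e s' t' up'| <= D &
      up -> arc_e e s t up = 0 /\ arc_e e s' t' up' = 0].
Proof.
move=> e0 e4 De h h' hs ht ht'.
have c0 : squash e t = 0 by apply: squash0 => //; move: ht; rewrite ler_norml; lra.
have c0' : squash e t' = 0 by apply: squash0 => //; move: ht'; rewrite ler_norml; lra.
have ups : if up then s = 1 else s <= 1 / 2.
  case: h ht {hs c0} => [_|//|k0 s0 _ _|k0 t0 /inv_nat_le2[_ ?] _ _]; rewrite ?normr1; lra.
have ups' : if up' then s' = 1 else s' <= 1 / 2.
  case: h' ht' {hs c0'} => [_|//|k0 s0 _ _|k0 t0 /inv_nat_le2[_ ?] _ _]; rewrite ?normr1; lra.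
rewrite /arc_e c0 c0'; move: hs; rewrite !ler_norml => hs.
move: ups ups'; case: up {h}; case: up' {h'} => hu hu'; split => //; try lra.
Qed.

(** The reciprocal closest to [1/k] is [1/(k+1)]. The case [k' = 0] covers p, since [0^-1 = 0]. *)
Lemma inv_nat_gap k k' : (2 <= k)%N -> k != k' ->
  (k%:R * (k%:R + 1))^-1 <= `|k%:R^-1 - k'%:R^-1| :> R.
Proof.
move=> k2 kk'; have k0 : 0 < k%:R :> R by rewrite ltr0n (leq_trans _ k2).
have k10 : 0 < k%:R + 1 :> R by lra.
have kE : (k%:R * (k%:R + 1))^-1 = k%:R^-1 - (k%:R + 1)^-1 :> R by field; rewrite !gt_eqF.
have ki : 0 < k%:R^-1 :> R by rewrite invr_gt0.
have k1i : 0 < (k%:R + 1)^-1 :> R by rewrite invr_gt0.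
case: k' kk' => [|n] kn; first by rewrite invr0 subr0 kE gtr0_norm//; lra.
have n0 : 0 < n.+1%:R :> R by [].
have ni : 0 < n.+1%:R^-1 :> R by rewrite invr_gt0.
have [lt_nk|le_kn] := ltnP n.+1 k.
  have nk : n.+1%:R + 1 <= k%:R :> R by rewrite natr1 ler_nat.
  rewrite distrC (_ : n.+1%:R^-1 - k%:R^-1 = (k%:R - n.+1%:R) * (k%:R * n.+1%:R)^-1); last first.
    by field; rewrite !gt_eqF.
  apply: (@le_trans _ _ (k%:R * n.+1%:R)^-1).
    by rewrite lef_pV2 ?posrE ?mulr_gt0// ler_pM2l//; lra.
  have inv0 : 0 < (k%:R * n.+1%:R)^-1 :> R by rewrite invr_gt0 mulr_gt0.
  by apply: le_trans (ler_norm _); rewrite ler_peMl ?(ltW inv0)// lerBrDl.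
have {}le_kn : (k < n.+1)%N by rewrite ltn_neqAle kn.
have kn' : k%:R + 1 <= n.+1%:R :> R by rewrite natr1 ler_nat.
have : n.+1%:R^-1 <= (k%:R + 1)^-1 :> R by rewrite lef_pV2.
by rewrite kE => h; apply: le_trans (ler_norm _); rewrite lerD2l lerN2.
Qed.

Lemma Y1_coord_down k s t : Y1_coord k s t false -> s = k%:R^-1.
Proof.
move: {-1}false (erefl false) => up /[swap] h; case: h => // _.
by rewrite invr0.
Qed.

Lemma Y1_coord_k k s t up : Y1_coord k s t up ->
  (2 <= k)%N \/ [/\ k = 0%N, s = 0, t = 0 & up = false].
Proof. by case=> *; [right|left|left|left]. Qed.

Lemma vec0 : vec 0 0 0 = @Y1_p R.
Proof. by apply/funext => i; rewrite /Y1_p /vec; case: ifP => //; rewrite if_same. Qed.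

(** The test function [F e] is an approximate arc distance from [x]: along S_k within the set of
    [x], through q elsewhere. In the limit it is attained by actual paths except at p, where it is 3
    plus the distance from q. *)
Lemma Y1_d0_ge (x : Y1 R) : x <> pt_p (Y1 R) ->
  (forall y, y <> pt_p (Y1 R) ->
     (length_metric (@dist R (Y1 R)) x y <= d0 (@dist R (Y1 R)) x y)%E) /\
  (3%:E + length_metric (@dist R (Y1 R)) (pt_q (Y1 R)) x <=
     d0 (@dist R (Y1 R)) x (pt_p (Y1 R)))%E.
Proof.
(* Points such as q and the corners have several coordinates; [c] selects one for each point. *)
move=> xp; have [c hc] := choice Y1_coordP.
pose K z := (c z).1.1.1; pose A z := arc (c z).1.1.2 (c z).1.2 (c z).2.
pose Ae e z := arc_e e (c z).1.1.2 (c z).1.2 (c z).2.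
have hcoord z : Y1_coord (K z) (c z).1.1.2 (c z).1.2 (c z).2 by case: (hc z).
have hval z : val z = vec (K z) (c z).1.1.2 (c z).1.2 by case: (hc z).
have K2 z : z <> pt_p (Y1 R) -> (2 <= K z)%N.
  move=> zp; have [//|[kz sz tz _]] := Y1_coord_k (hcoord z).
  by case: zp; apply: val_inj; rewrite hval kz sz tz vec0.
have k2 := K2 x xp.
pose F e z := if K z == K x then `|Ae e z - Ae e x| else Ae e x + Ae e z.
pose F0 z := if K z == K x then `|A z - A x| else A x + A z.
have Fx e : F e x = 0 by rewrite /F eqxx subrr normr0.
have gap0 : 0 < ((K x)%:R * ((K x)%:R + 1))^-1 :> R.
  by rewrite invr_gt0 mulr_gt0 ?addr_gt0 ?ltr0n// (leq_trans _ k2).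
have Flip e : 0 < e -> e < 1 / 4 -> lip (d0 (@dist R (Y1 R))) (F e).
  (* The scale stays below the gap around [1 / K x], so that no step leads from the third side of
     the set of [x] to the third side of another set or to p. *)
  move=> e0 e4; pose e' := Num.min e (((K x)%:R * ((K x)%:R + 1))^-1 / 2).
  have e'0 : 0 < e' by rewrite lt_min e0 divr_gt0.
  have e'e : e' <= e by rewrite ge_min lexx.
  have e'gap : e' < ((K x)%:R * ((K x)%:R + 1))^-1.
    apply: (@le_lt_trans _ _ (((K x)%:R * ((K x)%:R + 1))^-1 / 2)); last lra.
    by rewrite ge_min lexx orbT.
  apply: (lip_at_d0 e'0 Y1_pmetric) => z z' hz.
  have dE : dist z z' = (fine (dist z z'))%:E.
    rewrite fineK// ge0_fin_numE ?(pm_ge0 Y1_pmetric)//.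
    by apply: le_lt_trans hz _; rewrite ltry.
  set D := fine _ in dE; have De : D <= e' by rewrite -lee_fin -dE.
  have D0 : 0 <= D by rewrite -lee_fin -dE (pm_ge0 Y1_pmetric).
  rewrite dE lee_fin.
  have hd : (linf_dist (vec (K z) (c z).1.1.2 (c z).1.2)
      (vec (K z') (c z').1.1.2 (c z').1.2) <= D%:E)%E by rewrite -!hval -dE.
  have hs := linf_vec_ge1 hd.
  have [kk'|kk'] := eqVneq (K z) (K z').
    have hA : `|Ae e z - Ae e z'| <= D.
      have [k2z|[kz sz tz uz]] := Y1_coord_k (hcoord z).
        move: (hcoord z') hd; rewrite /Ae -kk' => hz' hd.
        apply: (arc_e_same e0 e4 _ k2z (hcoord z) hz' hs (linf_vec_ge2 k2z hd)).
        exact: le_trans e'e.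
      have [|[_ sz' tz' uz']] := Y1_coord_k (hcoord z'); first by rewrite -kk' kz.
      by rewrite /Ae sz tz uz sz' tz' uz' subrr normr0.
    rewrite /F kk'; case: ifP => _.
      apply: le_trans (ler_norm _) _; apply: le_trans (ler_dist_dist _ _) _.
      by rewrite opprB addrA subrK distrC.
    by move: hA; rewrite ler_norml; lra.
  have ht : `|(c z).1.2| <= D.
    have [k2z|[_ _ -> _]] := Y1_coord_k (hcoord z); last by rewrite normr0.
    exact: linf_vec_ge_other k2z kk' hd.
  have ht' : `|(c z').1.2| <= D.
    have [k2z|[_ _ -> _]] := Y1_coord_k (hcoord z'); last by rewrite normr0.
    rewrite eq_sym in kk'; apply: linf_vec_ge_other k2z kk' _.
    by rewrite (pm_sym linf_pmetric); exact: hd.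
  have [uu' hA hA0] := arc_e_other e0 e4 (le_trans De e'e) (hcoord z) (hcoord z') hs ht ht'.
  have Aex : 0 <= Ae e x.
    have [t01 s01 _] := Y1_coord_facts (hcoord x) k2.
    have := squash_bounds e0 e4 t01.
    have : 0 <= squash e (c x).1.2 by rewrite /squash subr_ge0 le_max lexx.
    by rewrite /Ae /arc_e; case: (c x).2; lra.
  (* Different sets joined near q: both points have [arc_e] equal to 0, and both branches of [F]
     give [Ae e x]. *)
  have [uz|nuz] := boolP (c z).2.
    have [z0 z'0] : Ae e z = 0 /\ Ae e z' = 0 by apply: hA0.
    by rewrite /F z0 z'0 !sub0r !normrN ger0_norm// addr0 !if_same subrr.
  have far w w' : Y1_coord (K w) (c w).1.1.2 (c w).1.2 (c w).2 ->
      (c w).2 = false -> (c w').2 = false -> K w != K w' ->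
      `|(c w).1.1.2 - (c w').1.1.2| <= D -> K w != K x.
    move=> _ uw uw' ww' hww'; apply/negP => /eqP kw.
    have := hcoord w; rewrite uw => /Y1_coord_down sw.
    have := hcoord w'; rewrite uw' => /Y1_coord_down sw'.
    have kw' : K x != K w' by rewrite -kw.
    have := inv_nat_gap k2 kw'; rewrite -kw -sw -sw' kw; lra.
  have uz : (c z).2 = false by exact: negbTE.
  have uz' : (c z').2 = false by rewrite -uu'.
  have zx := far z z' (hcoord z) uz uz' kk' hs.
  have z'x : K z' != K x.
    by apply: (far z' z (hcoord z') uz' uz); [rewrite eq_sym|rewrite distrC].
  by rewrite /F (negPf zx) (negPf z'x); move: hA; rewrite -!/(Ae e _) !ler_norml; lra.
(* Let [e] tend to 0: each of the two values of [arc_e] is off by at most [4 * e], whence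
   [b / 8]. *)
have lb z : ((F0 z)%:E <= d0 (@dist R (Y1 R)) x z)%E.
  apply/lee_addgt0Pr => b b0; pose e := Num.min (b / 8) (1 / 8).
  have e0 : 0 < e by rewrite lt_min; lra.
  have eb : e <= b / 8 by rewrite ge_min lexx.
  have e4 : e < 1 / 4.
    by apply: (@le_lt_trans _ _ (1 / 8)); rewrite ?ge_min ?lexx ?orbT//; lra.
  have := Flip e e0 e4 x z; rewrite Fx subr0 => h.
  apply: le_trans (leeD h (lexx b%:E)); rewrite -EFinD lee_fin.
  have hz := arc_e_bounds e0 e4 (hcoord z); have hx := arc_e_bounds e0 e4 (hcoord x).
  rewrite -!/(Ae e _) -!/(A _) in hz hx.
  rewrite /F0 /F; case: ifP => _; last lra.
  have h1 := ler_norm (Ae e z - Ae e x); have h2 := ler_norm (Ae e x - Ae e z).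
  by rewrite distrC in h2; rewrite ler_norml; lra.
have Apath z : z <> pt_p (Y1 R) ->
    [/\ 0 <= A z, A z <= 3 - (K z)%:R^-1 & z = to_Y1 (S_path (K z) (A z))].
  move=> /K2 k2z; have [A0 A3 Ez] := arc_path (hcoord z) k2z; split => //.
  by apply: val_inj; rewrite to_Y1K; [rewrite hval -Ez|exact: S_path_in].
have Aq z : z <> pt_p (Y1 R) ->
    (length_metric (@dist R (Y1 R)) (pt_q (Y1 R)) z <= (A z)%:E)%E.
  move=> zp; have [A0 A3 Ez] := Apath z zp; have k2z := K2 z zp.
  have [i0 i2] := inv_nat_le2 k2z.
  rewrite -(S_path0 k2z).
  have i3 : 0 <= 3 - (K z)%:R^-1 :> R by lra.
  have := S_path_length k2z (lexx 0) i3 A0 A3.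
  by rewrite -Ez subr0 ger0_norm.
split=> [y yp|]; last first.
  apply: le_trans (lb (pt_p (Y1 R))).
  (* The point p is filed under 0, since otherwise its first coordinate would be at least
     [1/k > 0]. *)
  have [|[kp sp tp up]] := Y1_coord_k (hcoord (pt_p (Y1 R))).
    move=> kp; have [t01 s01 _] := Y1_coord_facts (hcoord (pt_p (Y1 R))) kp.
    have s0 : 0 = (c (pt_p (Y1 R))).1.1.2.
      by have := congr1 (fun v : nat -> R => v 0%N) (hval (pt_p (Y1 R))).
    have [i0 _] := inv_nat_le2 kp.
    by move: s01; rewrite -s0 => /andP[/(lt_le_trans i0)]; rewrite ltxx.
  rewrite /F0 kp ifF; last by apply/negP => /eqP E; move: k2; rewrite -E.
  rewrite {2}/A sp tp up /arc.
  have -> : A x + (2 - 0 + (1 - 0)) = 3 + A x by lra.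
  by rewrite [leRHS]EFinD leeD2l// Aq.
apply: le_trans (lb y).
have [A0 A3 Ex] := Apath x xp; have [B0 B3 Ey] := Apath y yp.
rewrite /F0; case: eqP => [kyx|_].
  rewrite kyx in B3 Ey; have := S_path_length k2 A0 A3 B0 B3.
  by rewrite -Ex -Ey.
apply: le_trans (length_metric_tri Y1_pmetric _ (pt_q (Y1 R)) _) _.
rewrite EFinD; apply: leeD; last exact: Aq.
by rewrite (pm_sym (length_metric_pmetric Y1_pmetric)); exact: Aq.
Qed.

Lemma Y1_dist_pq : dist (pt_p (Y1 R)) (pt_q (Y1 R)) = 1%:E.
Proof.
apply/eqP; rewrite eq_le; apply/andP; split.
  apply: linf_dist_le => i; rewrite lee_fin /= /Y1_p /Y1_q.
  by case: ifP => _; rewrite sub0r normrN ?normr1// normr0.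
apply: le_trans (linf_dist_ge _ _ 0); rewrite lee_fin /= /Y1_p /Y1_q eqxx.
by rewrite sub0r normrN normr1.
Qed.

(** Jump from p to the bottom of an S_k with [1/k <= e], then follow S_k to q: the total is
    [1/k + (3 - 1/k)]. *)
Lemma Y1_d0_pq : (d0 (@dist R (Y1 R)) (pt_p (Y1 R)) (pt_q (Y1 R)) <= 3%:E)%E.
Proof.
apply: ge_ereal_sup => _ [e /= e0 <-].
pose k := (Num.bound e^-1).+2.
have k2 : (2 <= k)%N by [].
have [i0 i2] := inv_nat_le2 k2.
have ke : k%:R^-1 <= e :> R.
  rewrite -[e]invrK lef_pV2 ?posrE ?invr_gt0//.
  apply: ltW; apply: lt_le_trans (archi_boundP _) _; first by rewrite invr_ge0 ltW.
  by rewrite ler_nat /k -addn2 leq_addr.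
pose b := to_Y1 (S_path k (3 - k%:R^-1)).
have bE : val b = vec k k%:R^-1 0.
  rewrite to_Y1K; last by apply: S_path_in => //; lra.
  by rewrite /S_path; congr vec; rewrite /Num.max /Num.min; do ?case: ifPn; lra.
have pb : (dist (pt_p (Y1 R)) b <= k%:R^-1%:E)%E.
  rewrite /dist /= bE; apply: linf_dist_le => i; rewrite lee_fin /Y1_p /vec.
  case: ifP => _; first by rewrite sub0r normrN ger0_norm// ltW.
  by rewrite if_same subrr normr0 ltW.
apply: le_trans (deps_tri _ _ b _ Y1_pmetric) _.
have -> : 3 = k%:R^-1 + (3 - k%:R^-1) :> R by lra.
rewrite EFinD; apply: leeD.
  by apply: le_trans (deps_le_dist (le_trans pb _)) pb; rewrite lee_fin.
apply: le_trans (deps_le_d0 _ _ _ e0) _.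
apply: le_trans (d0_iter_le_length_metric Y1_pmetric 1 b (pt_q (Y1 R))) _.
have b3 : 0 <= 3 - k%:R^-1 :> R by lra.
have := S_path_length k2 b3 (lexx _) (lexx 0) b3.
by rewrite (S_path0 k2) sub0r normrN ger0_norm.
Qed.

End FirstSpace.

(** * The spaces Y_n *)

Section Layers.
Context (R : realType).

(** The function equal to 0 at [p] and to an arbitrary [K] elsewhere is constant along steps of
    length at most [c / 2]. *)
Lemma isolated_d0 (X : eqType) (r : X -> X -> \bar R) (c : R) (p : X) :
  0 < c -> pmetric r -> (forall x, x <> p -> (c%:E <= r x p)%E) ->
  forall y, y <> p -> d0 r p y = +oo%E.
Proof.
move=> c0 hr far y yp; apply/eqyP => K K0.
pose f z : R := if z == p then 0 else K.
have far2 x : x <> p -> ((c / 2)%:E < r x p)%E.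
  by move=> /far; apply: lt_le_trans; rewrite lte_fin; lra.
have c20 : 0 < c / 2 by lra.
have flip : lip (d0 r) f.
  apply: (lip_at_d0 c20 hr) => a b hab; rewrite /f; case: eqP => bp; case: eqP => ap.
  - by rewrite subrr (pm_ge0 hr).
  - by move: hab; rewrite bp leNgt far2.
  - by move: hab; rewrite ap (pm_sym hr) leNgt far2.
  - by rewrite subrr (pm_ge0 hr).
have := flip p y; rewrite /f eqxx; case: eqP => // _.
by rewrite subr0.
Qed.

(* The inductive invariant: [layered (tower R n) n.+1] holds for every [n]. The
   inequalities opposite to [ly_ge] and [ly_ge_p] follow from the other fields. *)
Record layered (Y : bipointed R) (n : nat) : Prop := Layered {
  ly_n : (0 < n)%N;
  ly_pm : pmetric (@dist R Y);
  ly_pq : (1%:E <= dist (pt_p Y) (pt_q Y))%E;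
  ly_le1 : forall k, (k < n)%N -> (d0_iter k (@dist R Y) (pt_p Y) (pt_q Y) <= 1%:E)%E;
  ly_le3 : (d0_iter n (@dist R Y) (pt_p Y) (pt_q Y) <= 3%:E)%E;
  ly_ge : forall x y, x <> pt_p Y -> y <> pt_p Y ->
    (length_metric (@dist R Y) x y <= d0_iter n (@dist R Y) x y)%E;
  ly_ge_p : forall x, x <> pt_p Y ->
    (3%:E + length_metric (@dist R Y) (pt_q Y) x <= d0_iter n (@dist R Y) x (pt_p Y))%E }.

Lemma Y1_layered : layered (Y1 R) 1.
Proof.
have le1 : (dist (pt_p (Y1 R)) (pt_q (Y1 R)) <= 1%:E)%E by rewrite Y1_dist_pq.
split => //; [exact: Y1_pmetric|by rewrite Y1_dist_pq|by case|
  exact: Y1_d0_pq|by move=> x y /Y1_d0_ge[h _] /h|by move=> x /Y1_d0_ge[]].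
Qed.

Section LayeredTheory.
Context (Y : bipointed R) (n : nat) (hY : layered Y n).

Let p := pt_p Y.
Let q := pt_q Y.
Let d := @dist R Y.
Let d_pm : pmetric d := ly_pm hY.
Let dn_pm k : pmetric (d0_iter k d) := d0_iter_pmetric k d_pm.

Lemma layered_pq : q <> p.
Proof.
by move=> qp; have := ly_pq hY; rewrite -/q qp (pm_refl (ly_pm hY)) lee_fin ler10.
Qed.

Lemma layered_isolated x : x <> p -> (3%:E <= d0_iter n d x p)%E.
Proof.
move=> xp; apply: le_trans (ly_ge_p hY xp); rewrite leeDl//.
exact: length_metric_ge0.
Qed.

Lemma layered_pq3 : (3%:E <= d0_iter n d p q)%E.
Proof. by rewrite (pm_sym (dn_pm n)); apply: layered_isolated; exact: layered_pq. Qed.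

Lemma layered_eq x y : x <> p -> y <> p -> d0_iter n d x y = length_metric d x y.
Proof.
move=> xp yp; apply/eqP; rewrite eq_le (ly_ge hY)// andbT.
exact: d0_iter_le_length_metric.
Qed.

Lemma layered_eq_p y : y <> p -> d0_iter n d p y = (3%:E + length_metric d q y)%E.
Proof.
move=> yp; apply/eqP; rewrite eq_le; apply/andP; split; last first.
  by rewrite (pm_sym (dn_pm n)); exact: ly_ge_p hY _ yp.
apply: le_trans (pm_tri (dn_pm n) _ q _) _; apply: leeD; first exact: ly_le3 hY.
exact: d0_iter_le_length_metric.
Qed.

Lemma layered_d0_p y : y <> p -> d0_iter n.+1 d p y = +oo%E.
Proof.
move=> yp; apply: (@isolated_d0 _ _ 3) yp => //; first exact: dn_pm.
exact: layered_isolated.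
Qed.

Lemma layered_d0_eq x y : d0_iter n.+1 d x y = length_metric d x y.
Proof.
apply/eqP; rewrite eq_le d0_iter_le_length_metric// andTb.
have far z : z <> p -> (length_metric d p z <= d0_iter n.+1 d p z)%E.
  by move=> /layered_d0_p ->; rewrite leey.
have [->|/eqP xp] := eqVneq x p; have [->|/eqP yp] := eqVneq y p.
- by rewrite length_metric_refl// (pm_ge0 (dn_pm n.+1)).
- exact: far.
- by rewrite (pm_sym (length_metric_pmetric d_pm)) (pm_sym (dn_pm n.+1)); exact: far.
apply: le_trans (ly_ge hY xp yp) _; exact: d0_iter_leS.
Qed.

(** Once two consecutive iterates agree, all later ones do, whereas the distance from p to q jumps
    from at most 3 to [+oo] at step [n.+1]. *)
Lemma layered_lt k : (k <= n)%N -> metric_lt (d0_iter k d) (d0_iter k.+1 d).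
Proof.
move=> kn; split; first by move=> x y; exact: d0_iter_leS.
apply: contrapT => hno.
have stab : d0_iter k.+1 d = d0_iter k d.
  apply/funext => x; apply/funext => y; apply/eqP; rewrite eq_le d0_iter_leS// andbT.
  by rewrite leNgt; apply/negP => h; apply: hno; exists x, y.
have stabs i : d0_iter (i + k) d = d0_iter k d.
  by elim: i => // i IH; rewrite addSn d0_iterS IH -d0_iterS.
have : d0_iter n.+1 d p q = d0_iter n d p q.
  by rewrite -(subnK kn) -addSn !stabs.
rewrite layered_d0_p; last exact: layered_pq.
by move=> E; have := ly_le3 hY; rewrite -/d -/p -/q -E leye_eq.
Qed.

End LayeredTheory.

(** Test functions are real-valued, so a possibly infinite bound is reached through its
    truncations. *)
Lemma le_of_trunc (v w : \bar R) :
  (forall K : R, 0 < K -> (mine K%:E v <= w)%E) -> (v <= w)%E.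
Proof.
move=> h; case: v h => [r| |] h; last by rewrite leNye.
  have := h (Num.max r 1); rewrite lt_max ltr01 orbT min_r; first exact.
  by rewrite lee_fin le_max lexx.
rewrite leye_eq; apply/eqP/eqyP => K K0.
by have := h K K0; rewrite min_l// leey.
Qed.

Section GlueLayer.
Context (Y : bipointed R) (n : nat) (hY : layered Y n).

Let d := @dist R Y.
Let D := @dist R (glue Y).
Let d_pm : pmetric d := ly_pm hY.
Let D_pm : pmetric D := glue_pmetric d_pm.
Let P := pt_p (glue Y).
Let Q := pt_q (glue Y).
Let cg := glue_chain_gluing d_pm (ly_pq hY).

Lemma glue_io_d0 k i j a b :
  (d0_iter k D (glue_io i j a) (glue_io i j b) <= (i.+1%:R^-1)%:E * d0_iter k d a b)%E.
Proof.
apply: (@d0_iter_scale _ _ _ d D (glue_io i j)) => // a' b'.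
exact: glue_io_dist.
Qed.

(** On a chain of [m.+1] copies with [c / m.+1 <= e], each copy is crossed in one step, and the
    steps add up to [c]. *)
Lemma glue_crossing k (c : R) : 0 < c -> (d0_iter k d (pt_p Y) (pt_q Y) <= c%:E)%E ->
  (d0_iter k.+1 D P Q <= c%:E)%E.
Proof.
move=> c0 hc; apply: ge_ereal_sup => _ [e /= e0 <-].
have Dk := d0_iter_pmetric k D_pm.
pose m := Num.bound (c / e).
have me : m.+1%:R^-1 * c <= e.
  rewrite mulrC ler_pdivrMr// mulrC -ler_pdivrMr//.
  apply: ltW; apply: lt_le_trans (archi_boundP _) _; first by rewrite divr_ge0 ?ltW.
  by rewrite ler_nat.
have step j : (deps (d0_iter k D) e (glue_io m j (pt_p Y)) (glue_io m j (pt_q Y)) <=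
    (m.+1%:R^-1 * c)%:E)%E.
  have h : (d0_iter k D (glue_io m j (pt_p Y)) (glue_io m j (pt_q Y)) <=
      (m.+1%:R^-1 * c)%:E)%E.
    by apply: le_trans (glue_io_d0 _ _ _ _ _) _; rewrite EFinM lee_pmul2l// lte_fin invr_gt0.
  by apply: le_trans (deps_le_dist (le_trans h _)) h; rewrite lee_fin.
have walk j : (j <= m)%N ->
    (deps (d0_iter k D) e P (glue_io m j (pt_q Y)) <= (j.+1%:R * (m.+1%:R^-1 * c))%:E)%E.
  elim: j => [_|j IH jm]; first by rewrite mul1r /P -(glue_io_p Y m); exact: step.
  apply: le_trans (deps_tri _ _ (glue_io m j (pt_q Y)) _ Dk) _.
  rewrite -[j.+2%:R]natr1 mulrDl mul1r EFinD; apply: leeD; first by apply: IH; exact: ltnW.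
  by rewrite glue_io_next.
have := walk m (leqnn m); rewrite glue_io_q mulrA divff ?mul1r//.
Qed.

(** Chains of at most [M.+1] copies are short and carry the truncated length distance from [x],
    changed at [P] alone to [vP]; longer chains interpolate between [vP] and [vQ]. *)
Lemma glue_test (x : glue Y) (K : R) (M : nat) : 0 < K -> x <> P ->
  (exists i j a, [/\ (i <= M)%N, (j <= i)%N & x = glue_io i j a]) ->
  (forall i j a, (i <= M)%N -> (j <= i)%N -> glue_io i j a <> P ->
     (mine K%:E (length_metric D x (glue_io i j a)) <=
       d0_iter n.+1 D x (glue_io i j a))%E) /\
  (mine K%:E (3%:E + length_metric D Q x) <= d0_iter n.+1 D x P)%E.
Proof.
move=> K0 xP [ix [jx [ax [ixM jxi xE]]]].
have L_pm := length_metric_pmetric D_pm.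
pose F z := trunc (length_metric D) K x z.
have FE z : (F z)%:E = mine K%:E (length_metric D x z) by exact: (truncE L_pm (ltW K0)).
(* The largest value up to [K] that the long chains allow, as crossing a copy costs at least 3
   before scaling. *)
pose vQ := F Q; pose vP := Num.min K (vQ + 3).
have vQK : vQ <= K by exact: (trunc_le L_pm (ltW K0)).
have vPQ : `|vQ - vP| <= 3.
  by rewrite ler_norml /vP /Num.min; case: ifPn; lra.
have c3 : 0 < 3 :> R by lra.
have d_n : pmetric (d0_iter n d) by exact: d0_iter_pmetric.
pose G (i j : nat) (a : Y) : R := if (i <= M)%N then
    if (j == 0%N) && (a == pt_p Y) then vP else F (glue_io i j a)
  else linear_chain (d0_iter n d) 3 i vP vQ j a.
have qp : pt_q Y == pt_p Y = false by apply/eqP; exact: layered_pq hY.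
have Gj : joined (Z := fun _ : nat => Y) id G vP vQ.
  split=> [i|i|i j ji]; rewrite /G; case: ifP => _.
  - by rewrite !eqxx.
  - exact: linear_chain0.
  - by rewrite qp andbF glue_io_q.
  - by apply: linear_chain_max => //; exact: layered_pq3 hY.
  - by rewrite qp andbF /= glue_io_next.
  - by apply: linear_chain_next => //; exact: layered_pq3 hY.
have [f hf] := cg_univ cg Gj.
have fP : f P = vP by rewrite /P -(glue_io_p Y 0) hf// /G !eqxx.
have fF i j a : (i <= M)%N -> (j <= i)%N -> glue_io i j a <> P ->
    f (glue_io i j a) = F (glue_io i j a).
  move=> iM ji aP; rewrite hf// /G iM; case: ifP => // /andP[/eqP j0 /eqP ap].
  by case: aP; rewrite j0 ap glue_io_p.
have fx : f x = 0 by rewrite {1}xE fF -?xE// /F (trunc_refl L_pm (ltW K0)).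
have flip : lip (d0_iter n.+1 D) f.
  (* At this scale a step in a copy of a short chain has unscaled length at most 1. As p is isolated
     there at distance 3, such a step cannot separate p from another point, and the changed value
     does no harm. *)
  have e0 : 0 < M.+1%:R^-1 :> R by rewrite invr_gt0.
  apply: (chain_gluing_lip_at cg e0) => i j ji a b hab; rewrite !hf// /G.
  have i0 : 0 < i.+1%:R^-1 :> R by rewrite invr_gt0.
  have [iM|iM] := leqP i M; last by apply: linear_chain_lip.
  have ab1 : (d0_iter n d a b <= 1%:E)%E.
    move: hab; rewrite /piece_dist -lee_pdivlMl// => /le_trans; apply.
    by rewrite -EFinM invrK lee_fin ler_pdivrMr// mul1r ler_nat.
  have [<-|/eqP ab] := eqVneq a b.
    by rewrite subrr (pm_ge0 (piece_dist_pmetric (Z := fun _ : nat => Y) id d_n)).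
  have far c : c <> pt_p Y -> (1%:E < d0_iter n d c (pt_p Y))%E.
    move=> cp; apply: lt_le_trans (layered_isolated hY cp); rewrite lte_fin; lra.
  have ap : a <> pt_p Y.
    move=> ap; move: ab1; rewrite ap (pm_sym d_n) leNgt far// => bp.
    by apply: ab; rewrite ap bp.
  have bp : b <> pt_p Y.
    by move=> bp; move: ab1; rewrite bp leNgt far.
  move/eqP/negPf: ap (ap) => ->; move/eqP/negPf: bp (bp) => -> bp ap; rewrite !andbF.
  apply: le_trans (trunc_lip L_pm (ltW K0) _ _ _) _.
  apply: (@le_trans _ _ ((i.+1%:R^-1)%:E * length_metric d a b)%E).
    by apply: length_metric_scale => // *; exact: glue_io_dist.
  by apply: lee_wpmul2l; [rewrite lee_fin ltW|exact: ly_ge hY _ _ ap bp].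
split=> [i j a iM ji aP|].
  by have := flip x (glue_io i j a); rewrite fx subr0 fF// FE.
have := flip x P; rewrite fx subr0 fP; apply: le_trans.
have -> : vP%:E = mine K%:E (mine K%:E (length_metric D x Q) + 3%:E)%E.
  by rewrite /vP EFin_min EFinD /vQ FE.
rewrite le_min ge_min lexx /= (pm_sym L_pm Q).
have [hK|hK] := leP K%:E (length_metric D x Q).
  by rewrite ge_min -EFinD lee_fin lerDl ltW// ltr0n.
by rewrite ge_min addeC lexx orbT.
Qed.

Lemma glue_layered : layered (glue Y) n.+1.
Proof.
split => //.
- exact: cg_dist_pq cg 0%N.
- case=> [_|k kn].
    rewrite -(glue_io_p Y 0) -(glue_io_q Y 0).
    apply: le_trans (glue_io_dist 0 0 (pt_p Y) (pt_q Y)) _; rewrite invr1 mul1e.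
    exact: ly_le1 hY 0%N (ly_n hY).
  by apply: glue_crossing => //; exact: ly_le1 hY k kn.
- by apply: glue_crossing => //; exact: ly_le3 hY.
- move=> x y xP yP.
  have [i [j [a [ji xE]]]] := glue_surj x; have [i' [j' [a' [ji' yE]]]] := glue_surj y.
  apply: le_of_trunc => K K0.
  (* With this [M] the chains of both points count as short. *)
  have [|h _] := @glue_test x K (maxn i i') K0 xP.
    by exists i, j, a; split => //; rewrite leq_maxl.
  by rewrite yE; apply: h => //; rewrite ?leq_maxr// -yE.
move=> x xP; have [i [j [a [ji xE]]]] := glue_surj x.
apply: le_of_trunc => K K0.
by have [|_] := @glue_test x K i K0 xP; first by exists i, j, a.
Qed.

End GlueLayer.

Lemma tower_layered n : layered (tower R n) n.+1.
Proof. by elim: n => [|n IH]; [exact: Y1_layered|exact: glue_layered]. Qed.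

End Layers.

(** * The space Y_infinity *)

Section Union.
Context (R : realType).

Definition tower_next (u : tower_sum R) : tower_sum R :=
  in_tower (glue_inj (projT2 u) : tower R (projT1 u).+1).

Lemma tower_next_step u : tower_step u (tower_next u).
Proof. by case: u => n y; exact: Tower_step. Qed.

Lemma gen_class_next i u :
  gen_class (@tower_step R) (iter i tower_next u) = gen_class (@tower_step R) u.
Proof.
elim: i => // i <-; apply/esym/gen_class_eq.
exact: tower_next_step.
Qed.

Lemma to_Yinf_next n (y : tower R n) : to_Yinf (glue_inj y : tower R n.+1) = to_Yinf y.
Proof. exact: (gen_class_next 1 (in_tower y)). Qed.

(** [tower_step] is the graph of [tower_next], so equivalent elements have a common iterate. *)
Lemma gen_class_tower_eq u v :
  gen_class (@tower_step R) u = gen_class (@tower_step R) v ->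
  exists i j, iter i tower_next u = iter j tower_next v.
Proof.
move=> /gen_classP; elim=> {u v} [_ _ [n y]|u|u v _ [i [j E]]|u v w _ [i [j E]] _ [i' [j' E']]].
- by exists 1%N, 0%N.
- by exists 0%N, 0%N.
- by exists j, i.
by exists (i' + i)%N, (j + j')%N; rewrite [LHS]iterD E [RHS]iterD -E' -!iterD addnC.
Qed.

(** A distance stated on the disjoint union, which can be rewritten along equalities there without
    casts between stages. *)
Definition same_stage (l : \bar R) (u v : tower_sum R) :=
  exists n (a b : tower R n), [/\ u = in_tower a, v = in_tower b & l = dist a b].

Lemma same_stage_next i l u v : same_stage l u v ->
  exists2 l', (l' <= l)%E & same_stage l' (iter i tower_next u) (iter i tower_next v).
Proof.
move=> huv; elim: i => [|i [l' l'l [n [a [b [ea eb E]]]]]]; first by exists l.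
exists (dist (glue_inj a : tower R n.+1) (glue_inj b)).
  apply: le_trans l'l; rewrite E /glue_inj !glue_pt_io.
  by apply: le_trans (glue_io_dist _ _ _ _) _; rewrite invr1 mul1e.
by exists n.+1, (glue_inj a : tower R n.+1), (glue_inj b : tower R n.+1); rewrite /= ea eb.
Qed.

Lemma same_stage_tri l l' u v w : same_stage l u v -> same_stage l' v w ->
  exists2 l'', (l'' <= l + l')%E & same_stage l'' u w.
Proof.
move=> [n [a [b [-> -> ->]]]] [n' [b' [c [E -> ->]]]].
have nn' : n = n' by have := congr1 (@projT1 _ _) E.
subst n'.
have bb' : b = b' by exact: (Eqdep_dec.inj_pair2_eq_dec _ PeanoNat.Nat.eq_dec) E.
rewrite -{}bb' {E}; exists (dist a c); last by exists n, a, c.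
exact: pm_tri (ly_pm (tower_layered R n)) _ _ _.
Qed.

Lemma Yinf_surj (x : Yinf R) : exists n (a : tower R n), x = to_Yinf a.
Proof. by have [[n a] ->] := gen_class_surj x; exists n, a. Qed.

Lemma to_Yinf_dist n (a b : tower R n) :
  (Yinf_dist (to_Yinf a) (to_Yinf b) <= dist a b)%E.
Proof. by apply: ereal_inf_lbound; exists n, a, b. Qed.

Lemma Yinf_pmetric : pmetric (@Yinf_dist R).
Proof.
have dist0 n (a b : tower R n) : (0 <= dist a b)%E by exact: pm_ge0 (ly_pm (tower_layered R n)) _ _.
have ge0 (x y : Yinf R) : (0 <= Yinf_dist x y)%E.
  by apply: le_ereal_inf_tmp => _ [n [a [b [_ _ ->]]]].
have sym_le (x y : Yinf R) : (Yinf_dist x y <= Yinf_dist y x)%E.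
  apply: ereal_inf_le_tmp => _ [n [a [b [ha hb ->]]]]; exists n, b, a; split => //.
  exact: pm_sym (ly_pm (tower_layered R n)) _ _.
split => //.
- move=> x; apply/eqP; rewrite eq_le ge0 andbT.
  have [n [a ->]] := Yinf_surj x; apply: le_trans (to_Yinf_dist _ _) _.
  by rewrite (pm_refl (ly_pm (tower_layered R n))).
- by move=> x y; apply/eqP; rewrite eq_le !sym_le.
move=> x y z; apply: le_ereal_infD.
- by move=> _ [n [a [b [_ _ ->]]]].
- by move=> _ [n [a [b [_ _ ->]]]].
move=> _ _ [n [a [b [ha hb ->]]]] [n' [b' [c [hb' hc ->]]]].
(* Both pairs are pushed forward until the two representatives of [y] coincide; the triangle
   inequality is then that of one stage. *)
have [i [j bb']] : exists i j,
    iter i tower_next (in_tower b) = iter j tower_next (in_tower b').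
  by apply: gen_class_tower_eq; rewrite -/(to_Yinf b) -/(to_Yinf b') hb hb'.
have [|l1 l1l s1] := @same_stage_next i (dist a b) (in_tower a) (in_tower b).
  by exists n, a, b.
have [|l2 l2l s2] := @same_stage_next j (dist b' c) (in_tower b') (in_tower c).
  by exists n', b', c.
rewrite -bb' in s2; have [l3 l3l [N [a3 [c3 [ea ec E]]]]] := same_stage_tri s1 s2.
apply: le_trans (leeD l1l l2l); apply: le_trans l3l; rewrite E.
have <- : to_Yinf a3 = x by rewrite /to_Yinf -ea gen_class_next.
have <- : to_Yinf c3 = z by rewrite /to_Yinf -ec gen_class_next.
exact: to_Yinf_dist.
Qed.

Definition Yinf_p : Yinf R := to_Yinf (pt_p (tower R 0)).
Definition Yinf_q : Yinf R := to_Yinf (pt_q (tower R 0)).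

Lemma to_Yinf_p n : to_Yinf (pt_p (tower R n)) = Yinf_p.
Proof. by elim: n => // n <-; exact: (to_Yinf_next (pt_p (tower R n))). Qed.

Lemma to_Yinf_q n : to_Yinf (pt_q (tower R n)) = Yinf_q.
Proof. by elim: n => // n <-; exact: (to_Yinf_next (pt_q (tower R n))). Qed.

(* [Some (n, m)] stands for the chain of [m.+2] copies of [tower n] that is
   added in [tower n.+1], and [None] for Y_1. *)
Definition Yinf_index := option (nat * nat)%type.

Definition Yinf_level (i : Yinf_index) : nat := if i is Some (n, _) then n else 0.

Definition Yinf_size (i : Yinf_index) : nat := if i is Some (_, m) then m.+1 else 0.

Definition Yinf_io (i : Yinf_index) (j : nat) : tower R (Yinf_level i) -> Yinf R :=
  match i with
  | Some (n, m) => fun a => to_Yinf (glue_io m.+1 j a : tower R n.+1)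
  | None => fun a => to_Yinf a
  end.

Lemma glue_io00 (Y : bipointed R) (a : Y) : glue_io 0 0 a = glue_inj a.
Proof. by rewrite /glue_inj glue_pt_io. Qed.

Lemma Yinf_io_surj (x : Yinf R) : exists i j (a : tower R (Yinf_level i)),
  (j <= Yinf_size i)%N /\ x = Yinf_io j a.
Proof.
have [n [a ->]] := Yinf_surj x; elim: n a => [|n IH] a; first by exists None, 0%N, a.
have [[|m] [j [b [jm ->]]]] := glue_surj a; last by exists (Some (n, m)), j, b.
have -> : j = 0%N by case: j jm.
by rewrite glue_io00 to_Yinf_next; exact: IH.
Qed.

(** The function is built stage by stage. The single-copy chain of a stage carries the previous
    function, the other chains carry [g]; recording the values at p and q makes them fit
    together. *)
Lemma Yinf_univ (g : forall i : Yinf_index, nat -> tower R (Yinf_level i) -> R) vP vQ :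
  joined (Z := fun i => tower R (Yinf_level i)) Yinf_size g vP vQ ->
  exists f : Yinf R -> R, forall i j a, (j <= Yinf_size i)%N -> f (Yinf_io j a) = g i j a.
Proof.
move=> [gp gq gn].
pose S n := {h : tower R n -> R | h (pt_p _) = vP /\ h (pt_q _) = vQ}.
pose next n (h : tower R n -> R) (h' : tower R n.+1 -> R) :=
  (forall a, h' (glue_inj a) = h a) /\
  (forall m j a, (j <= m.+1)%N -> h' (glue_io m.+1 j a) = g (Some (n, m)) j a).
have ext n (s : S n) : exists s' : S n.+1, next n (sval s) (sval s').
  case: s => h [hp hq] /=.
  pose G (i j : nat) (a : tower R n) : R :=
    if i is m.+1 then g (Some (n, m)) j a else h a.
  have Gj : joined (Z := fun _ : nat => tower R n) id G vP vQ.
    split=> [[|m]|[|m]|[|m] j jm] //=; exact: gn.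
  have L := tower_layered R n.
  have cg := glue_chain_gluing (ly_pm L) (ly_pq L).
  have [h' hh'] := cg_univ cg Gj.
  have h'p : h' (pt_p (tower R n.+1)) = vP /\ h' (pt_q (tower R n.+1)) = vQ.
    by rewrite -(glue_io_p _ 0) -(glue_io_q _ 0) !hh'.
  exists (exist _ h' h'p); split => /= [a|m j a jm]; last by rewrite hh'.
  by rewrite -glue_io00 hh'.
have s0P : g None 0%N (pt_p (tower R 0)) = vP /\ g None 0%N (pt_q (tower R 0)) = vQ.
  by split; [exact: gp|exact: gq].
pose F n : S n := nat_rect S (exist _ (g None 0%N) s0P)
  (fun n s => projT1 (cid (ext n s))) n.
have FS n : next n (sval (F n)) (sval (F n.+1)) by exact: projT2 (cid (ext n (F n))).
have [f hf] : exists f : Yinf R -> R, forall u, f (gen_class (@tower_step R) u) =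
    sval (F (projT1 u)) (projT2 u).
  by apply: gen_quot_lift => _ _ [n y] /=; rewrite (FS n).1.
exists f; case=> [[n m]|] j a jm; rewrite /Yinf_io /to_Yinf hf //.
  exact: (FS n).2.
by move: jm; rewrite leqn0 => /eqP ->.
Qed.

Lemma Yinf_chain_gluing :
  chain_gluing (Z := fun i => tower R (Yinf_level i)) Yinf_size (@Yinf_dist R)
    Yinf_p Yinf_q Yinf_io.
Proof.
split.
- exact: Yinf_io_surj.
- case=> [[n m]|] //=; rewrite -(to_Yinf_p n.+1); congr to_Yinf; exact: glue_io_p.
- case=> [[n m]|] //=; rewrite -(to_Yinf_q n.+1); congr to_Yinf; exact: glue_io_q.
- by case=> [[n m]|] //= j jm; congr to_Yinf; exact: glue_io_next.
- exact: Yinf_univ.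
- move=> f hf; have flip n : lip (@dist R (tower R n)) (fun a => f (to_Yinf a)).
    elim: n => [|n IH].
      by move=> a b; have := hf None 0%N isT a b; rewrite /piece_dist invr1 mul1e.
    apply: glue_lip => -[|m] j jm a b; last exact: hf (Some (n, m)) j jm a b.
    have -> : j = 0%N by case: j jm.
    by rewrite !glue_io00 !to_Yinf_next invr1 mul1e; exact: IH.
  by move=> x y; apply: le_ereal_inf_tmp => _ [n [a [b [<- <- ->]]]]; exact: flip.
- exact: Yinf_pmetric.
- by move=> i; exact: ly_pm (tower_layered R _).
- by move=> i; exact: ly_pq (tower_layered R _).
Qed.

Let D := @Yinf_dist R.
Let D_pm k : pmetric (d0_iter k D) := d0_iter_pmetric k Yinf_pmetric.

Lemma Yinf_pq : Yinf_q <> Yinf_p.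
Proof.
move=> E; have := cg_dist_pq Yinf_chain_gluing None.
by rewrite E (pm_refl Yinf_pmetric) lee_fin ler10.
Qed.

(* In [d_0^k] for large [k], the point y and the pieces of its chain are
   isolated from p, so that a path to p must use another chain. *)
Lemma Yinf_far y : y <> Yinf_p -> exists k, (1%:E <= d0_iter k D y Yinf_p)%E.
Proof.
move=> yp; have [i0 [j0 [b [ji0 yE]]]] := Yinf_io_surj y.
(* In the pieces of the chain of [y], p is isolated for iterate [n]; [chain_gluing_lip_at] costs one
   more. *)
pose n := (Yinf_level i0).+1; exists n.+1.
have L : layered (tower R (Yinf_level i0)) n by exact: tower_layered.
have dn_pm i : pmetric (d0_iter n (@dist R (tower R (Yinf_level i)))).
  by apply: d0_iter_pmetric; exact: ly_pm (tower_layered R _).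
have dn_pq i : (1%:E <= d0_iter n (@dist R (tower R (Yinf_level i))) (pt_p _) (pt_q _))%E.
  apply: le_trans (ly_pq (tower_layered R _)) _.
  by apply: (@d0_iter_nondec _ _ 0%N) => //; exact: ly_pm (tower_layered R _).
(* The jump at p on the chain of [y] is invisible to small steps; the other chains interpolate from
   0 to 1. *)
pose g (i : Yinf_index) (j : nat) (a : tower R (Yinf_level i)) : R :=
  if i == i0 then if (j == 0%N) && (a == pt_p _) then 0 else 1
  else linear_chain (d0_iter n (@dist R (tower R (Yinf_level i)))) 1 (Yinf_size i) 0 1 j a.
have qp i : pt_q (tower R (Yinf_level i)) == pt_p (tower R (Yinf_level i)) = false.
  by apply/eqP; exact: layered_pq (tower_layered R _).
have gj : joined (Z := fun i => tower R (Yinf_level i)) Yinf_size g 0 1.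
  split=> [i|i|i j _]; rewrite /g; case: ifP => _.
  - by rewrite !eqxx.
  - exact: linear_chain0.
  - by rewrite qp andbF.
  - exact: linear_chain_max.
  - by rewrite qp andbF.
  - exact: linear_chain_next.
have [f hf] := Yinf_univ gj.
have [fp _] := cg_ends Yinf_chain_gluing None gj hf.
have fy : f y = 1.
  rewrite yE hf// /g eqxx; case: ifP => // /andP[/eqP j00 /eqP bp].
  by case: yp; rewrite yE j00 bp (cg_p Yinf_chain_gluing).
have e0 : 0 < (Yinf_size i0).+1%:R^-1 :> R by rewrite invr_gt0.
have flip : lip (d0_iter n.+1 D) f.
  apply: (chain_gluing_lip_at Yinf_chain_gluing e0) => i j ji a a' haa'; rewrite !hf// /g.
  have [ii0|ii0] := eqVneq i i0; last by apply: linear_chain_lip; rewrite ?subr0 ?normr1.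
  subst i; have d_n := dn_pm i0.
  have i_gt0 : 0 < (Yinf_size i0).+1%:R^-1 :> R by [].
  have aa'1 : (d0_iter n (@dist R (tower R (Yinf_level i0))) a a' <= 1%:E)%E.
    move: haa'; rewrite /piece_dist -lee_pdivlMl// => /le_trans; apply.
    by rewrite -EFinM mulVf// gt_eqF.
  have far c : c <> pt_p _ ->
      (1%:E < d0_iter n (@dist R (tower R (Yinf_level i0))) c (pt_p _))%E.
    by move=> cp; apply: lt_le_trans (layered_isolated L cp); rewrite lte_fin; lra.
  case: (eqVneq a (pt_p _)) => [ap|/eqP ap]; case: (eqVneq a' (pt_p _)) => [a'p|/eqP a'p].
  - by rewrite subrr (pm_ge0 (piece_dist_pmetric Yinf_size d_n)).
  - by move: aa'1; rewrite ap (pm_sym d_n) leNgt far.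
  - by move: aa'1; rewrite a'p leNgt far.
  - by rewrite subrr (pm_ge0 (piece_dist_pmetric Yinf_size d_n)).
by have := flip Yinf_p y; rewrite fp fy subr0 (pm_sym (D_pm n.+1)).
Qed.

(** [tower n] is Y_(n+1), where the first [n] iterates still keep p and q within 1. *)
Lemma Yinf_d0_pq n : (d0_iter n D Yinf_p Yinf_q <= 1%:E)%E.
Proof.
rewrite -(to_Yinf_p n) -(to_Yinf_q n).
apply: le_trans (ly_le1 (tower_layered R n) (ltnSn n)).
rewrite -[leRHS]mul1e; apply: d0_iter_scale => //; first exact: ly_pm (tower_layered R n).
by move=> a b; rewrite mul1e; exact: to_Yinf_dist.
Qed.

(** Take for [y] the middle of the chain of two copies of [tower n]: contraction by 1/2 halves the
    bound 1. *)
Lemma Yinf_near n : exists2 y, y <> Yinf_p & (d0_iter n D y Yinf_p <= (1 / 2)%:E)%E.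
Proof.
have L := tower_layered R n; have L' := tower_layered R n.+1.
pose i : Yinf_index := Some (n, 0%N).
pose y : Yinf R := @Yinf_io i 0%N (pt_q (tower R n)).
exists y.
  (* The function running linearly from 0 to 1 on all chains takes the value 1/2 at [y], hence [y]
     is not p. *)
  have lj := linear_joined Yinf_chain_gluing 0 0 1.
  have [f hf] := Yinf_univ lj; have [fp _] := cg_ends Yinf_chain_gluing None lj hf.
  move=> yp; have : f y = 0 by rewrite yp.
  rewrite /y hf// linear_chain_q//; [|exact: ly_pm L|exact: ly_pq L].
  by move=> /eqP; rewrite add0r subr0 mul1r mulf_eq0 invr_eq0 !pnatr_eq0.
rewrite (pm_sym (D_pm n)) -(to_Yinf_p n.+1) -(glue_io_p _ 1).
have h1 := @glue_io_d0 R (tower R n) n.+1 L n 1 0 (pt_p _) (pt_q _).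
apply: (@le_trans _ _ (d0_iter n (@dist R (tower R n.+1))
    (glue_io 1 0 (pt_p (tower R n))) (glue_io 1 0 (pt_q (tower R n))))).
  rewrite -[leRHS]mul1e.
  apply: (@d0_iter_scale _ _ _ _ D (@to_Yinf R n.+1)) => //; first exact: ly_pm L'.
  by move=> a b; rewrite mul1e; exact: to_Yinf_dist.
apply: le_trans h1 _; rewrite div1r -[leRHS]mule1 lee_pmul2l ?lte_fin ?invr_gt0//.
exact: ly_le1 L _ (ltnSn n).
Qed.

(** Stationarity at [n] would freeze the distance at most 1/2 of the point from [Yinf_near], against
    [Yinf_far]. *)
Lemma Yinf_d0_lt n : metric_lt (d0_iter n D) (d0_iter n.+1 D).
Proof.
split; first by move=> x y; apply: d0_iter_leS; exact: Yinf_pmetric.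
apply: contrapT => hno.
have stab : d0_iter n.+1 D = d0_iter n D.
  apply/funext => x; apply/funext => y; apply/eqP.
  rewrite eq_le d0_iter_leS ?andbT//; last exact: Yinf_pmetric.
  by rewrite leNgt; apply/negP => h; apply: hno; exists x, y.
have stabs i : d0_iter (i + n) D = d0_iter n D.
  by elim: i => // i IH; rewrite addSn d0_iterS IH -d0_iterS.
have [y yp hy] := Yinf_near n; have [k hk] := Yinf_far yp.
have : (d0_iter k D y Yinf_p <= d0_iter (k + n) D y Yinf_p)%E.
  by apply: d0_iter_nondec; [exact: Yinf_pmetric|rewrite leq_addr].
rewrite stabs => /(le_trans hk)/le_trans/(_ hy); rewrite lee_fin; lra.
Qed.

(** By [Yinf_far], p is isolated for the length metric, so the operation [d0] applied to it gives
    [+oo] at (p, q) without exceeding it. *)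
Lemma Yinf_length_pq : length_metric D Yinf_p Yinf_q = +oo%E.
Proof.
have L_pm := length_metric_pmetric Yinf_pmetric.
apply/eqP; rewrite -leye_eq.
rewrite -(@isolated_d0 _ _ _ 1 Yinf_p ltr01 L_pm _ _ Yinf_pq).
  exact: d0_length_metric Yinf_pmetric _ _.
move=> x /Yinf_far[k hk]; apply: le_trans hk _.
exact: d0_iter_le_length_metric Yinf_pmetric _ _ _.
Qed.

Lemma Yinf_cvg x y : cvgn (fun n => d0_iter n D x y).
Proof.
apply: ereal_nondecreasing_is_cvgn => n m nm.
by apply: d0_iter_nondec nm; exact: Yinf_pmetric.
Qed.

Lemma Yinf_lim_lt : metric_lt (fun x y => limn (fun n => d0_iter n D x y)) (length_metric D).
Proof.
split=> [x y|].
  apply: lime_le; first exact: Yinf_cvg.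
  by apply: nearW => n; exact: d0_iter_le_length_metric Yinf_pmetric _ _ _.
exists Yinf_p, Yinf_q; rewrite Yinf_length_pq; apply: (@le_lt_trans _ _ 1%:E); last by rewrite ltry.
apply: lime_le; first exact: Yinf_cvg.
by apply: nearW => n; exact: Yinf_d0_pq.
Qed.

End Union.

Theorem proposition3p3 (R : realType) :
  (forall (n : nat) (n_gt0 : (0 < n)%N),
    let d := @dist R (Y R n) in
    let p := pt_p (Y R n) in
    let q := pt_q (Y R n) in
    [/\ forall y : Y R n, y <> p ->
          d0_iter n d p y = (3%:E + length_metric d q y)%E,
        forall x y : Y R n, x <> p -> y <> p ->
          d0_iter n d x y = length_metric d x y,
        forall k : nat, (k <= n)%N -> metric_lt (d0_iter k d) (d0_iter k.+1 d) &
        forall x y : Y R n, d0_iter n.+1 d x y = length_metric d x y]) /\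
  (let d := @Yinf_dist R in
   [/\ forall n : nat, metric_lt (d0_iter n d) (d0_iter n.+1 d),
       forall x y : Yinf R, cvgn (fun n => d0_iter n d x y) &
       metric_lt (fun x y => limn (fun n => d0_iter n d x y))
                 (length_metric d)]).
Proof.
split.
  move=> n n_gt0; have L : layered (Y R n) n by rewrite -{2}(prednK n_gt0); exact: tower_layered.
  split.
  - exact: layered_eq_p L.
  - exact: layered_eq L.
  - exact: layered_lt L.
  - exact: layered_d0_eq L.
split; [exact: Yinf_d0_lt|exact: Yinf_cvg|exact: Yinf_lim_lt].
Qed.
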